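(* If $t \geq r+1$, then \[\mathrm{ex}_r(n,\text{Berge-}K_{2,t})\le(1+o(1)) \frac{\sqrt{t-1}\,\binom{t}{r-1}}{r t} n^{3/2}.\] If $t\le r$, then \[\mathrm{ex}_r(n,\text{Berge-}K_{2,t})\le (1+o(1)) \frac{\sqrt{t-1}}{2} n^{3/2}.\] In particular, if $r=3$ and $t\ge 4$, then \[ \mathrm{ex}_3(n,\text{Berge-}K_{2,t})=(1+o(1))\frac{1}{6}(t-1)^{3/2}n^{3/2}. \]
   Context: All graphs and hypergraphs are finite and simple. The integers $r$ (the uniformity of the hypergraphs) and $t$ are fixed, and $o(1)$ refers to $n\to\infty$. A hypergraph $\mathcal{H}$ contains a Berge-$F$ (Berge copy of the graph $F$) if there are an injection $\varphi:V(F)\to V(\mathcal{H})$ and an injection $f:E(F)\to E(\mathcal{H})$ with $\{\varphi(u),\varphi(v)\}\subset f(uv)$ for every edge $uv\in E(F)$; otherwise it is Berge-$F$-free. $\mathrm{ex}_r(n,\text{Berge-}F)$ is the maximum number of hyperedges in an $n$-vertex $r$-uniform Berge-$F$-free hypergraph. $K_{2,t}$ is the complete bipartite graph with parts of sizes $2$ and $t$.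
   Formalization: We assume r ≥ 1 and t ≥ 2: for t = 1 ≤ r the second bound would read ex ≤ (1+o(1))·0, which is false since disjoint hyperedges are Berge-K_{2,1}-free, and for r = 0 the formulas are undefined. *)

(* Defs.v *)
From HB Require Import structures.
From mathcomp Require Import all_boot all_order all_algebra.
From mathcomp Require Import all_classical all_reals all_analysis.
Set Implicit Arguments.
Unset Strict Implicit.
Unset Printing Implicit Defensive.
Import Order.TTheory GRing.Theory Num.Theory.
Import numFieldNormedType.Exports.
Local Open Scope ring_scope.

(* A finite simple hypergraph on the finite vertex type V is its set of
   hyperedges H : {set {set V}}; simple graphs are the 2-uniform ones. *)
Definition uniform (V : finType) (r : nat) (H : {set {set V}}) : bool :=
  [forall e in H, #|e| == r].

(* f is total on {set U}, but only its values on the edge set F matter. For an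
   edge e = uv, phi @: e is {phi u, phi v}. *)
Definition contains_berge (U V : finType) (F : {set {set U}})
    (H : {set {set V}}) : bool :=
  [exists phi : {ffun U -> V}, exists f : {ffun {set U} -> {set V}},
    [&& injectiveb phi, dinjectiveb f (mem F) &
        [forall e in F, (f e \in H) && (phi @: e \subset f e)]]].

Lemma contains_bergeP (U V : finType) (F : {set {set U}})
    (H : {set {set V}}) :
  reflect (exists (phi : U -> V) (f : {set U} -> {set V}),
             [/\ injective phi, {in F &, injective f} &
                 forall e, e \in F -> f e \in H /\ phi @: e \subset f e])
          (contains_berge F H).
Proof.
apply: (iffP existsP) => [[phi /existsP[f /and3P[iphi /dinjectiveP jf /forall_inP h]]]|].
  by exists phi, f; split=> //; [exact/injectiveP | move=> e /h /andP].
move=> [phi [f [iphi jf h]]]; exists (finfun phi); apply/existsP.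
exists (finfun f); apply/and3P; split.
- by apply/injectiveP => x y; rewrite !ffunE; exact: iphi.
- by apply/dinjectiveP => x y xF yF; rewrite !ffunE; exact: jf.
- apply/forall_inP => e /h[fe pe]; rewrite ffunE fe /=.
  by rewrite (eq_imset _ (ffunE phi)).
Qed.

Definition ex_berge (r n : nat) (U : finType) (F : {set {set U}}) : nat :=
  \max_(H : {set {set 'I_n}} | uniform r H && ~~ contains_berge F H) #|H|.

Definition complete_bipartite (s t : nat) : {set {set 'I_s + 'I_t}} :=
  [set [set inl i; inr j] | i : 'I_s, j : 'I_t]%SET.

Lemma complete_bipartite_uniform (s t : nat) :
  uniform 2 (complete_bipartite s t).
Proof. by apply/forall_inP => _ /imset2P[i j _ _ ->]; rewrite cards2. Qed.

(* u n <= (1 + o(1)) v n *)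
Definition asymp_le (R : realType) (u v : nat -> R) : Prop :=
  exists2 o : nat -> R, (o @ \oo --> (0 : R))%classic &
    forall n, u n <= (1 + o n) * v n.

(* u n = (1 + o(1)) v n *)
Definition asymp_eq (R : realType) (u v : nat -> R) : Prop :=
  exists2 o : nat -> R, (o @ \oo --> (0 : R))%classic &
    forall n, u n = (1 + o n) * v n.

(* Main.v *)
(* Upper bounds.  Let H be Berge-F-free.  Choosing X in H maximal for
   |X| - |shadow X|, Hall's theorem matches the pairs in the shadow of X into X,
   and H \ X into the remaining pairs.  The matched pairs form an F-free graph,
   red in the shadow of X and blue elsewhere, and |H| is at most the number of
   blue edges plus the number of red r-cliques.  For F = K_{2,t} an edge lies in
   at most C(t-1, r-2) cliques of size r, and the graph has at most
   (sqrt (t-1) n^(3/2) + n) / 2 edges (Kovari-Sos-Turan).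

   Lower bound for r = 3.  Put k = t - 1 and let Q be a prime power with
   k | Q - 1.  Füredi's graph on the (Q^2-1)/k orbits of the group of k-th roots
   of unity mu on F_Q^2 \ 0, where u ~ v iff u1 v2 + u2 v1 is in mu, is
   K_{2,k+1}-free and has about Q^3/6 triangles; these are the hyperedges.

   Every n must be close to such an order.  Taking Q = q^phi(k) makes k | Q - 1
   automatic for q coprime to k, so no prime number theorem in progressions is
   needed: it suffices that prime powers q are dense on a multiplicative scale,
   which follows from psi(x) ~ x.  The latter is proved by Selberg's method, with
   E(N) = psi(N) - N: the Tatuzawa-Iseki identity gives
   E(N) ln N + sum Lambda(n) E(N/n) = O(N), hence, after iteration,
   |E(N)| ln^2 N <= 2 sum (ln n) |E(N/n)| + O(N ln N).
   Since sum E(m)/(m(m+1)) is bounded, every window [y, Ky] contains a stretch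
   where E is small, so a bound |E(N)| <= beta N improves by a fixed factor. *)
Require Import Defs.
From HB Require Import structures.
From mathcomp Require Import all_boot all_order all_algebra.
From mathcomp Require Import all_classical all_reals all_analysis.
From mathcomp Require Import cyclic finfield.
From mathcomp Require Import ring lra zify.
Import Order.TTheory GRing.Theory Num.Theory.
Import numFieldNormedType.Exports.
Set Implicit Arguments.
Unset Strict Implicit.
Unset Printing Implicit Defensive.
Local Open Scope ring_scope.

(** * Divisor sums and the von Mangoldt function *)

(** The lower bound must keep its leading constant, so the usable orders Q have to be dense in ratio
    1 + o(1); Chebyshev-type bounds would lose a constant factor. Hence psi(x) ~ x. The obstacle
    there is that the first identity averages E against Lambda, the very function under study.
    Iterating it produces the weight Lambda ln + Lambda * Lambda (Dirichlet convolution), whose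
    partial sums are 2 ln N! + O(N), so partial summation can exchange it for the smooth weight 2 ln
    n. Inserting |E(m)| <= beta m on the right merely returns beta up to O(1 / ln N); any fixed
    saving in every logarithmic window therefore makes the bound contract. All of this stays on
    natural numbers, with [N %/ n] for N/n. The explicit constants are crude: only their finiteness
    matters. In Füredi's graph, the conditions form(u,w), form(v,w) in mu have k^2 solutions w when
    u, v are independent, and these make up k orbits: passing to orbits of mu is what brings the
    codegree to k = t - 1. *)

Lemma sum_multiples (V : nmodType) (N d : nat) (F : nat -> V) : (0 < d)%N ->
  \sum_(1 <= k < N.+1 | (d %| k)%N) F k = \sum_(1 <= m < (N %/ d).+1) F (d * m)%N.
Proof.
move=> d0; elim: N => [|N IH]; first by rewrite div0n !big_geq.
rewrite big_mkcond big_nat_recr //= -big_mkcond IH divnS //.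
case: ifPn => dN; last by rewrite addr0 add0n.
rewrite add1n [RHS]big_nat_recr //=; congr (_ + F _).
by rewrite -[in LHS](divnK dN) divnS // dN add1n mulnC.
Qed.

Lemma sum_divisors (V : nmodType) (N : nat) (H : nat -> nat -> V) :
  \sum_(1 <= k < N.+1) \sum_(1 <= d < k.+1 | (d %| k)%N) H d k =
  \sum_(1 <= d < N.+1) \sum_(1 <= m < (N %/ d).+1) H d (d * m)%N.
Proof.
transitivity (\sum_(1 <= k < N.+1) \sum_(1 <= d < N.+1 | (d %| k)%N) H d k).
  apply: eq_big_nat => k /andP[k1 kN].
  rewrite [RHS](big_cat_nat (n := k.+1)) //=.
  rewrite [X in _ = _ + X]big_nat_cond [X in _ = _ + X]big1 ?addr0 // => d.
  by case/andP=> /andP[kd _] /dvdn_leq -/(_ k1); rewrite leqNgt kd.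
rewrite (exchange_big_dep xpredT) //=; apply: eq_big_nat => d /andP[d1 _].
exact: (sum_multiples N (H d)).
Qed.

Lemma sum_hyperbola (V : nmodType) (N : nat) (F : nat -> nat -> V) :
  \sum_(1 <= d < N.+1) \sum_(1 <= m < (N %/ d).+1) F d m =
  \sum_(1 <= m < N.+1) \sum_(1 <= d < (N %/ m).+1) F d m.
Proof.
have E (G : nat -> nat -> V) : \sum_(1 <= d < N.+1) \sum_(1 <= m < (N %/ d).+1) G d m =
   \sum_(1 <= d < N.+1) \sum_(1 <= m < N.+1 | (d * m <= N)%N) G d m.
  apply: eq_big_nat => d /andP[d1 dN].
  rewrite [RHS](big_cat_nat (n := (N %/ d).+1)) //=; last first.
    by rewrite ltnS leq_div.
  rewrite [X in _ = _ + X]big_nat_cond [X in _ = _ + X]big1 ?addr0; last first.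
    move=> m /andP[/andP[+ _]]; rewrite ltn_divLR // mulnC => h; by rewrite leqNgt h.
  apply: congr_big_nat => // m /andP[m1]; rewrite ltnS leq_divRL // mulnC.
  by move=> ->.
rewrite E E; rewrite (exchange_big_dep xpredT) //=.
by apply: eq_bigr => m _; apply: eq_bigl => d; rewrite mulnC.
Qed.

Section Mangoldt.
Variable R : realType.

(** For a prime power exactly one pair (p, i) contributes, otherwise none; the ranges suffice
    because p <= n and i < n whenever p ^ i = n with p prime and i >= 1. *)
Definition mangoldt (n : nat) : R :=
  \sum_(0 <= p < n.+1 | prime p) \sum_(1 <= i < n.+1 | (p ^ i == n)%N) ln p%:R.

Lemma mangoldt_ge0 n : 0 <= mangoldt n.
Proof.
apply: sumr_ge0 => p pp; apply: sumr_ge0 => i _.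
by rewrite ln_ge0 // ler1n prime_gt0.
Qed.

Lemma mangoldt_neq0 n : mangoldt n != 0 ->
  exists p i, [/\ prime p, (0 < i)%N & n = (p ^ i)%N].
Proof.
apply: contra_neqP => h; rewrite /mangoldt big1 // => p pp.
rewrite big_nat_cond big1 // => i /andP[/andP[i1 _] /eqP e].
by case: h; exists p, i.
Qed.

(** A range for (p, i) that does not depend on n is what allows the exchange with a sum over the
    divisors n. *)
Lemma mangoldt_wide n m : (n <= m)%N -> mangoldt n =
  \sum_(0 <= p < m.+1 | prime p) \sum_(1 <= i < m.+1 | (p ^ i == n)%N) ln p%:R.
Proof.
move=> nm; rewrite /mangoldt [RHS](big_cat_nat (n := n.+1)) //=.
rewrite [X in _ = _ + X]big_nat_cond [X in _ = _ + X]big1 ?addr0; last first.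
  move=> p /andP[/andP[np _] pp]; rewrite big_nat_cond big1 // => i.
  case/andP=> /andP[i1 _] /eqP e; suff : (p <= n)%N by rewrite leqNgt np.
  by rewrite -e -{1}[p]expn1 leq_exp2l // prime_gt1.
apply: eq_bigr => p pp; rewrite [RHS](big_cat_nat (n := n.+1)) //=.
rewrite [X in _ = _ + X]big_nat_cond [X in _ = _ + X]big1 ?addr0 // => i.
case/andP=> /andP[ni _] /eqP e; suff : (i < n)%N by rewrite ltnNge (ltnW ni).
by rewrite -e ltn_expl // prime_gt1.
Qed.

(** The pairs (p, i) with p ^ i dividing n give ln p with multiplicity [logn p n]; this is the
    logarithm of the prime factorisation. *)
Lemma sum_mangoldt n : (0 < n)%N ->
  \sum_(1 <= d < n.+1 | (d %| n)%N) mangoldt d = ln n%:R.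
Proof.
move=> n0.
transitivity (\sum_(0 <= p < n.+1 | prime p) \sum_(1 <= i < n.+1)
   \sum_(1 <= d < n.+1 | (d %| n)%N && (p ^ i == d)%N) (ln p%:R : R)).
  rewrite big_nat_cond; under eq_bigr => d.
    rewrite ltnS => /andP[/andP[_ dn] _]; rewrite (mangoldt_wide dn).
    under eq_bigr => p _ do rewrite big_mkcond.
    over.
  rewrite -big_nat_cond exchange_big /=; apply: eq_bigr => p pp.
  rewrite exchange_big /=; apply: eq_bigr => i _.
  by rewrite -big_mkcondr.
transitivity (\sum_(0 <= p < n.+1 | prime p) (ln p%:R *+ logn p n : R)).
  apply: eq_bigr => p pp.
  transitivity (\sum_(1 <= i < n.+1 | (p ^ i %| n)%N) (ln p%:R : R)).
    rewrite [RHS]big_mkcond; apply: eq_big_nat => i /andP[i1 _].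
    rewrite -big_filter; case: ifPn => pin; last first.
      rewrite big_filter big1 // => d /andP[dn /eqP e]; by rewrite e dn in pin.
    rewrite big_filter big_mkcondl.
    under eq_bigl => d do rewrite eq_sym.
    rewrite (big_nat_widenl _ 0%N) //= big_mkcondr.
    rewrite big_mkord.
    have pn : (p ^ i < n.+1)%N by rewrite ltnS dvdn_leq.
    rewrite (big_pred1 (Ordinal pn)) /= ?pin ?expn_gt0 ?prime_gt0 //.
  under eq_bigl => i do rewrite pfactor_dvdn //.
  rewrite (big_cat_nat (n := (logn p n).+1)) //=; last first.
    rewrite ltnS ltnW // (leq_trans (ltn_expl _ (prime_gt1 pp))) //.
    by rewrite dvdn_leq // pfactor_dvdnn.
  rewrite [X in _ + X]big_nat_cond [X in _ + X]big1 ?addr0; last first.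
    by move=> i /andP[/andP[+ _]]; rewrite ltnNge => /negP.
  rewrite big_nat_cond (eq_bigl (fun i => 1 <= i < (logn p n).+1)%N); last first.
    move=> i; rewrite ltnS; case: (1 <= i)%N => //=; by rewrite andbb.
  by rewrite -big_nat sumr_const_nat subn1.
rewrite -[in RHS](partnT n0) big_mkcond /=.
have : forall m, \sum_(0 <= i < m) (if prime i then (ln i%:R : R) *+ logn i n else 0) =
   ln (\prod_(0 <= p < m) p ^ logn p n)%:R.
  elim=> [|m IH]; first by rewrite !big_geq // ln1.
  rewrite !big_nat_recr //= natrM lnM; last 2 first.
  - rewrite posrE ltr0n; elim/big_rec: _ => // i x _ x0.
    by rewrite muln_gt0 x0 andbT expn_gt0; case: i => //=; rewrite lognE.
  - by rewrite posrE ltr0n expn_gt0; case: m {IH} => //=; rewrite lognE.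
  rewrite IH; congr (_ + _); case: ifPn => mp; first by rewrite natrX lnXn // ltr0n prime_gt0.
  by rewrite lognE (negbTE mp) expn0 ln1.
by move=> ->.
Qed.

Lemma mangoldt_le n : (0 < n)%N -> mangoldt n <= ln n%:R.
Proof.
move=> n0; rewrite -(sum_mangoldt n0) big_mkcond big_nat_recr //= dvdnn lerDr.
by apply: sumr_ge0 => i _; case: ifP => // _; exact: mangoldt_ge0.
Qed.

End Mangoldt.

(** * The Möbius function *)

(** Both sides run over the pairs with d * e dividing k. *)
Lemma sum_divisors_swap (V : nmodType) (k : nat) (F : nat -> nat -> V) : (0 < k)%N ->
  \sum_(1 <= d < k.+1 | (d %| k)%N)
     \sum_(1 <= e < (k %/ d).+1 | (e %| k %/ d)%N) F d e =
  \sum_(1 <= e < k.+1 | (e %| k)%N)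
     \sum_(1 <= d < (k %/ e).+1 | (d %| k %/ e)%N) F d e.
Proof.
move=> k0.
have E (G : nat -> nat -> V) : \sum_(1 <= d < k.+1 | (d %| k)%N)
     \sum_(1 <= e < (k %/ d).+1 | (e %| k %/ d)%N) G d e =
   \sum_(1 <= d < k.+1) \sum_(1 <= e < (k %/ d).+1)
      (if (d * e %| k)%N then G d e else 0).
  rewrite big_mkcond; apply: eq_big_nat => d /andP[d0 _]; rewrite -big_mkcond.
  case: ifPn => dk; first by apply: eq_bigl => e; rewrite dvdn_divRL // mulnC.
  rewrite big1 // => e; rewrite mulnC => /(dvdn_trans (dvdn_mull _ (dvdnn _))).
  by rewrite (negbTE dk).
rewrite E E sum_hyperbola; apply: eq_bigr => e _; apply: eq_bigr => d _.
by rewrite mulnC.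
Qed.

Section Mobius.
Variable R : realType.

(* [:: 1; -1]`_e is 1, -1 and 0 for e = 0, e = 1 and e >= 2. *)
Definition mobius (n : nat) : R :=
  \prod_(0 <= p < n.+1 | prime p) [:: 1; -1]`_(logn p n).

Lemma mobius_wide n m : (0 < n <= m)%N ->
  mobius n = \prod_(0 <= p < m.+1 | prime p) [:: 1; -1]`_(logn p n).
Proof.
move=> /andP[n0 nm]; rewrite [RHS](big_cat_nat (n := n.+1)) //=.
rewrite [X in _ = _ * X]big_nat_cond [X in _ = _ * X]big1 ?mulr1 // => p.
case/andP=> /andP[np _] _; have -> : logn p n = 0%N; last by [].
by rewrite lognE n0 /=; case: ifP => // /andP[_ /dvdn_leq -/(_ n0)]; rewrite leqNgt np.
Qed.

Lemma normr_mobius n : `|mobius n| <= 1.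
Proof.
rewrite normr_prod; apply: prodr_ile1 => i _; rewrite normr_ge0 /=.
case: (logn i n) => [|[|j]] /=; rewrite ?normr1 ?normrN1 //.
by rewrite nth_nil normr0.
Qed.

Lemma mobius_primeM p e : prime p -> (0 < e)%N ->
  mobius (p * e) = if (p %| e)%N then 0 else - mobius e.
Proof.
move=> pp e0.
have p0 := prime_gt0 pp.
have pe0 : (0 < p * e)%N by rewrite muln_gt0 p0.
have le1 : (p <= p * e)%N by rewrite leq_pmulr.
have le2 : (e <= p * e)%N by rewrite leq_pmull.
rewrite (@mobius_wide e (p * e)) ?e0 // /mobius !big_mkord.
have pl : (p < (p * e).+1)%N by [].
rewrite (bigD1 (Ordinal pl)) //= [in RHS](bigD1 (Ordinal pl)) //=.
rewrite lognM // [logn p p]lognE pp p0 dvdnn /= divnn p0 logn1.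
rewrite [X in _ * X = _](eq_bigr (fun i : 'I__ => [:: 1; -1]`_(logn i e))); last first.
  move=> i /andP[pi]; rewrite -val_eqE /= => ip; rewrite lognM //.
  by rewrite [logn i p]logn_prime // (negbTE ip).
case: ifPn => pe.
  by rewrite -(@prednK (logn p e)) ?logn_gt0 ?mem_primes ?pp ?e0 //= nth_nil mul0r.
have -> : logn p e = 0%N by rewrite lognE pp e0 (negbTE pe).
by rewrite /= mulN1r mul1r.
Qed.

Lemma mobius1 : mobius 1 = 1.
Proof. by rewrite /mobius big_mkcond big_nat_recl // big_nat1 /= mulr1. Qed.

(** For a prime p dividing n, the divisors prime to p cancel against their p-fold multiples, and the
    multiples of p ^ 2 contribute nothing. *)
Lemma sum_mobius n : (0 < n)%N ->
  \sum_(1 <= d < n.+1 | (d %| n)%N) mobius d = (n == 1%N)%:R.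
Proof.
move=> n0; case: eqVneq => [->|n1]; first by rewrite big_mkcond big_nat1 /= mobius1.
have {}n1 : (1 < n)%N by rewrite ltn_neqAle eq_sym n1.
set p := pdiv n; have pp : prime p by exact: pdiv_prime.
have p0 := prime_gt0 pp; have pn : (p %| n)%N by exact: pdiv_dvd.
rewrite (bigID (dvdn p)) /=.
under eq_bigl => d do rewrite andbC.
rewrite big_mkcondr (sum_multiples n (fun d => if (d %| n)%N then mobius d else 0) p0).
rewrite -big_mkcond big_nat_cond.
under eq_bigr => m /andP[/andP[m0 _] _] do rewrite mobius_primeM //.
rewrite -big_nat_cond.
rewrite [X in _ + X](_ : _ = \sum_(1 <= d < (n %/ p).+1 | (p * d %| n)%N)
    if (p %| d)%N then 0 else mobius d).
  rewrite -big_split big1 //= => d _; case: ifP => _; first by rewrite addr0.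
  by rewrite addNr.
rewrite [LHS](big_cat_nat (n := (n %/ p).+1)) //=; last by rewrite ltnS leq_div.
have E d : (d %| n)%N && ~~ (p %| d)%N = (p * d %| n)%N && ~~ (p %| d)%N.
  case pd: (p %| d)%N; rewrite ?andbF //= !andbT Gauss_dvd ?pn //.
  by rewrite prime_coprime // pd.
rewrite [X in _ + X]big_nat_cond [X in _ + X]big1 ?addr0; last first.
  move=> d; rewrite E => /andP[/andP[nd _] /andP[/dvdn_leq -/(_ n0) h _]].
  by move: nd; rewrite ltn_divLR // ltnNge mulnC h.
under eq_bigl => d do rewrite E.
by rewrite big_mkcondr; apply: eq_bigr => d _; rewrite if_neg.
Qed.

(** Möbius inversion of ln = Lambda * 1 gives the sum of mu(d) ln(k/d) as Lambda(k). The part with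
    ln k drops out: the sum of mu(d) vanishes unless k = 1, and ln 1 = 0. *)
Lemma sum_mobius_ln k : (0 < k)%N ->
  \sum_(1 <= d < k.+1 | (d %| k)%N) mobius d * ln d%:R = - mangoldt R k.
Proof.
move=> k0.
have : \sum_(1 <= d < k.+1 | (d %| k)%N) mobius d * (ln k%:R - ln d%:R) = mangoldt R k.
  transitivity (\sum_(1 <= d < k.+1 | (d %| k)%N)
     \sum_(1 <= e < (k %/ d).+1 | (e %| k %/ d)%N) mobius d * mangoldt R e).
    rewrite big_nat_cond [RHS]big_nat_cond.
    apply: eq_bigr => d /andP[/andP[d0 _] dk]; rewrite -mulr_sumr; congr (_ * _).
    have kd0 : (0 < k %/ d)%N by rewrite divn_gt0 // dvdn_leq.
    rewrite sum_mangoldt // -{1}(divnK dk) natrM lnM ?posrE ?ltr0n // addrK //.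
  rewrite sum_divisors_swap // big_mkcond big_nat_recr //= dvdnn.
  rewrite -mulr_suml divnn k0 sum_mobius // eqxx mul1r.
  rewrite big_nat_cond big1 ?add0r // => e /andP[/andP[e0 ek] _].
  case: ifP => // de; rewrite -mulr_suml sum_mobius ?divn_gt0 // ?(ltnW ek) //.
  case: eqVneq => [k1|]; last by rewrite mul0r.
  by move: ek; rewrite -(divnK de) k1 mul1n ltnn.
under eq_bigr => d _ do rewrite mulrBr.
rewrite big_split /= sumrN -mulr_suml sum_mobius // => <-.
by case: eqVneq => [->|_]; rewrite ?ln1 ?mul1r ?mul0r sub0r opprK.
Qed.

(** Collecting the coefficient of F(k), the twist of mu by ln(N/d) yields ln N at k = 1 plus
    Lambda(k). If the sums of F over multiples grow slowly, the left side is small, and F(1) ln N is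
    expressed by the values F(k). *)
Lemma tatuzawa_iseki (N : nat) (F : nat -> R) : (0 < N)%N ->
  \sum_(1 <= d < N.+1) mobius d * (ln N%:R - ln d%:R) *
     (\sum_(1 <= m < (N %/ d).+1) F (d * m)%N) =
  ln N%:R * F 1%N + \sum_(1 <= k < N.+1) mangoldt R k * F k.
Proof.
move=> N0.
under eq_bigr => d _ do rewrite mulr_sumr.
rewrite -(sum_divisors N (fun d k => mobius d * (ln N%:R - ln d%:R) * F k)).
rewrite (eq_big_nat _ _ (F2 := fun k => ((k == 1%N)%:R * ln N%:R + mangoldt R k) * F k)); last first.
  move=> k /andP[k0 kN]; rewrite -mulr_suml; congr (_ * _).
  under eq_bigr => d _ do rewrite mulrBr.
  rewrite big_split /= sumrN -mulr_suml sum_mobius // sum_mobius_ln // opprK //.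
under eq_bigr => k _ do rewrite mulrDl.
rewrite big_split /=; congr (_ + _).
rewrite big_nat_recl //= mul1r big_nat_cond big1 ?addr0 // => k /andP[/andP[k0 _] _].
by rewrite eqSS eqn0Ngt k0 !mul0r.
Qed.

End Mobius.

(** * Chebyshev and Mertens estimates *)

Section Chebyshev.
Variable R : realType.
Local Notation Lam := (mangoldt R).
Local Notation L n := (ln (n%:R : R)).

Lemma ln_le_subr1 (x : R) : 0 < x -> ln x <= x - 1.
Proof. by move=> x0; rewrite -{1}(subrK 1 x) addrC le_ln1Dx // ltrBDl subrr. Qed.

Lemma ln_ge_1subV (x : R) : 0 < x -> 1 - x^-1 <= ln x.
Proof.
move=> x0; have := @ln_le_subr1 x^-1; rewrite invr_gt0 lnV ?posrE // => /(_ x0).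
lra.
Qed.

Lemma lnn_ge0 n : 0 <= L n.
Proof. by case: n => [|n]; [rewrite ln0 | rewrite ln_ge0 // ler1n]. Qed.

Lemma lnn_le n m : (0 < n)%N -> (n <= m)%N -> L n <= L m.
Proof. by move=> n0 nm; rewrite ler_ln ?posrE ?ltr0n ?ler_nat // (leq_trans n0). Qed.

Lemma lnnM n m : (0 < n)%N -> (0 < m)%N -> L (n * m)%N = L n + L m.
Proof. by move=> n0 m0; rewrite natrM lnM // posrE ltr0n. Qed.

Lemma lnn_lt n : L n <= n%:R.
Proof.
case: n => [|n]; first by rewrite ln0.
by have := @ln_le_subr1 n.+1%:R; rewrite ltr0n => /(_ isT) h; lra.
Qed.

Lemma lnn_step n : (0 < n)%N ->
  n.+1%:R^-1 <= L n.+1 - L n <= (n%:R : R)^-1.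
Proof.
move=> n0; have n0R : (0 : R) < n%:R by rewrite ltr0n.
have n1R : (0 : R) < n.+1%:R by rewrite ltr0n.
have q0 : (0 : R) < n.+1%:R / n%:R by rewrite divr_gt0.
rewrite -ln_div ?posrE //.
have -> : (n.+1%:R : R)^-1 = 1 - (n.+1%:R / n%:R)^-1.
  by rewrite -natr1 in n1R *; field; rewrite !gt_eqF.
rewrite ln_ge_1subV //= (le_trans (ln_le_subr1 q0)) //.
have -> // : n.+1%:R / n%:R - 1 = (n%:R : R)^-1.
by rewrite -natr1 in n1R *; field; rewrite gt_eqF.
Qed.

Definition harmonic_sum (N : nat) : R := \sum_(1 <= n < N.+1) n%:R^-1.

Lemma harmonic_sumS N : harmonic_sum N.+1 = harmonic_sum N + N.+1%:R^-1.
Proof. by rewrite /harmonic_sum big_nat_recr. Qed.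

(** The sequence H(n) - ln(n+1) increases, H(n) - ln n decreases, and they differ by at most 1/n; g
    is the supremum of the first. *)
Lemma euler_mascheroni : exists2 g : R, 0 <= g <= 1 &
  forall N, (0 < N)%N -> `|harmonic_sum N - L N - g| <= N%:R^-1.
Proof.
pose a n := harmonic_sum n - L n.+1.
pose b n := harmonic_sum n - L n.
have ab n : (0 < n)%N -> a n <= b n <= a n + n%:R^-1.
  by move=> n0; have /andP[h1 h2] := lnn_step n0; rewrite /a /b; have := lnn_le n0 (leqnSn n) => ?; apply/andP; lra.
have aS n : a n <= a n.+1.
  by have /andP[h1 h2] := lnn_step (ltn0Sn n); rewrite /a harmonic_sumS; set u := _^-1 in h2 *; lra.
have bS n : (0 < n)%N -> b n.+1 <= b n.
  by move=> n0; have /andP[h1 h2] := lnn_step n0; rewrite /b harmonic_sumS; set u := _^-1 in h1 *; lra.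
have aH n m : (n <= m)%N -> a n <= a m.
  by apply: (@homo_leq _ a (fun x y => x <= y)) => //; exact: le_trans.
have bH n m : (0 < n <= m)%N -> b m <= b n.
  move=> /andP[n0 nm]; rewrite -(subnKC nm); elim: (m - n)%N => [|k IH]; first by rewrite addn0.
  by rewrite addnS (le_trans _ IH) // bS // addn_gt0 n0.
have abm n m : (0 < m)%N -> a n <= b m.
  move=> m0; have mx : (0 < maxn n m)%N by rewrite leq_max m0 orbT.
  have /andP[h1 _] := ab _ mx.
  rewrite (le_trans (aH _ _ (leq_maxl n m))) // (le_trans h1) //.
  by rewrite bH // m0 leq_maxr.
pose A := [set a n | n in [set: nat]]%classic.
have A0 : (A !=set0)%classic by exists (a 0%N); exists 0%N.
have Aub m : (0 < m)%N -> ubound A (b m) by move=> m0 _ [n _ <-]; exact: abm.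
have sA : has_sup A by split=> //; exists (b 1%N); exact: Aub.
have sle m : (0 < m)%N -> sup A <= b m by move=> m0; apply: ge_sup => //; exact: Aub.
have leS n : a n <= sup A by apply: ub_le_sup; [case: sA | exists n].
exists (sup A).
  apply/andP; split.
    by rewrite (le_trans _ (leS 0%N)) // /a /harmonic_sum big_geq // ln1 subrr.
  by rewrite (le_trans (sle 1%N isT)) // /b /harmonic_sum big_nat1 ln1 subr0 invr1.
move=> N N0; have /andP[h1 h2] := ab _ N0; have := sle _ N0; have := leS N.
by rewrite ler_norml -/(b N); lra.
Qed.

Definition ln_fact (N : nat) : R := \sum_(1 <= n < N.+1) L n.

Lemma ln_factS N : ln_fact N.+1 = ln_fact N + L N.+1.
Proof. by rewrite /ln_fact big_nat_recr. Qed.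

Lemma stirling N : (0 < N)%N ->
  N%:R * L N - N%:R <= ln_fact N <= N%:R * L N - N%:R + 1 + L N.
Proof.
case: N => // N _; elim: N => [|N IH].
  by rewrite /ln_fact big_nat1 ln1; apply/andP; lra.
have /andP[h1 h2] := lnn_step (ltn0Sn N).
rewrite ln_factS; move: IH h1 h2.
set n := N.+1%:R; have n0 : (0 : R) < n by rewrite ltr0n.
have -> : (N.+2%:R : R) = n + 1 by rewrite natr1.
move=> /andP[a1 a2].
have n1 : (0 : R) < n + 1 by lra.
move=> h1 h2.
have h3 : 1 <= (n + 1) * (ln (n + 1) - ln n) by rewrite mulrC -ler_pdivrMr // div1r.
have h4 : n * (ln (n + 1) - ln n) <= 1 by rewrite mulrC -ler_pdivlMr // div1r.
by apply/andP; lra.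
Qed.

Definition chebyshev_psi (N : nat) : R := \sum_(1 <= n < N.+1) Lam n.
Local Notation psi := chebyshev_psi.

Lemma psiS N : psi N.+1 = psi N + Lam N.+1.
Proof. by rewrite /psi big_nat_recr. Qed.

Lemma psi0 : psi 0 = 0. Proof. by rewrite /psi big_geq. Qed.

Lemma psi_le n m : (n <= m)%N -> psi n <= psi m.
Proof.
apply: (@homo_leq _ psi (fun x y => x <= y)) => //; first exact: le_trans.
by move=> i; rewrite psiS lerDl mangoldt_ge0.
Qed.

Lemma psi_ge0 n : 0 <= psi n. Proof. by rewrite -psi0 psi_le. Qed.

Lemma ln_fact_mangoldt N :
  ln_fact N = \sum_(1 <= d < N.+1) Lam d * (N %/ d)%:R.
Proof.
transitivity (\sum_(1 <= k < N.+1) \sum_(1 <= d < k.+1 | (d %| k)%N) Lam d).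
  by apply: eq_big_nat => k /andP[k0 _]; rewrite sum_mangoldt.
rewrite (sum_divisors N (fun d _ => Lam d)); apply: eq_bigr => d _.
by rewrite sumr_const_nat subn1 mulr_natr.
Qed.

Lemma ln_fact_psi N : ln_fact N = \sum_(1 <= m < N.+1) psi (N %/ m).
Proof.
rewrite ln_fact_mangoldt -(sum_hyperbola N (fun d _ => Lam d)).
by apply: eq_bigr => d _; rewrite sumr_const_nat subn1 mulr_natr.
Qed.

(** With M = [N %/ 2], the coefficient floor(N/d) - 2 floor(M/d) of Lambda(d) is never negative and
    is at least 1 for M < d <= N. *)
Lemma psi_half N : psi N - psi (N %/ 2) <= ln_fact N - 2 * ln_fact (N %/ 2).
Proof.
set M := (N %/ 2)%N; have MN : (M < N.+1)%N by rewrite ltnS leq_div.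
have -> : ln_fact M = \sum_(1 <= d < N.+1) Lam d * (M %/ d)%:R.
  rewrite ln_fact_mangoldt [RHS](big_cat_nat (n := M.+1)) //=.
  rewrite [X in _ = _ + X]big_nat_cond [X in _ = _ + X]big1 ?addr0 // => d.
  by case/andP=> /andP[h _] _; rewrite divn_small // mulr0.
rewrite ln_fact_mangoldt mulr_sumr -sumrB.
rewrite /psi (big_cat_nat (n := M.+1) (p := N.+1)) //= addrAC subrr add0r.
rewrite [X in _ <= X](big_cat_nat (n := M.+1)) //=.
have key d : (0 < d)%N -> (2 * (M %/ d) <= N %/ d)%N.
  by move=> d0; rewrite /M -divnMA [(2 * d)%N]mulnC divnMA; lia.
rewrite -[X in X <= _]add0r lerD //.
  rewrite big_nat_cond sumr_ge0 // => d /andP[/andP[d0 _] _].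
  rewrite mulrCA -mulrBr mulr_ge0 ?mangoldt_ge0 // subr_ge0 -natrM ler_nat key //.
rewrite ler_sum_nat // => d /andP[Md dN].
have d0 : (0 < d)%N by apply: leq_trans Md.
rewrite mulrCA -mulrBr ler_peMr ?mangoldt_ge0 // [(M %/ d)%N]divn_small // mulr0 subr0.
by rewrite ler1n divn_gt0.
Qed.

(** Strong induction by halving: Stirling bounds the increment in [psi_half] linearly, using ln N <=
    ln M + 2, which follows from N <= 3 M. *)
Lemma chebyshev N : psi N <= 10 * N%:R.
Proof.
elim/ltn_ind: N => N IH.
case: (ltnP N 2) => N2.
  have -> : psi N = 0.
    case: N N2 {IH} => [|[|//]] _; rewrite ?psi0 // psiS psi0 add0r.
    by apply/eqP; rewrite eq_le mangoldt_ge0 (le_trans (mangoldt_le _ _)) // ln1.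
  by rewrite mulr_ge0.
have := psi_half N; set M := (N %/ 2)%N.
have M0 : (0 < M)%N by rewrite divn_gt0.
have MN : (M < N)%N by rewrite ltn_Pdiv // ltnW.
have /andP[s1 _] := stirling M0; have N0 : (0 < N)%N by lia.
have /andP[_ s2] := stirling N0; have := IH _ MN.
have N3 : L N <= L M + 2.
  rewrite (le_trans (@lnn_le N (3 * M) _ _)) //; first by rewrite /M; lia.
  rewrite lnnM // addrC lerD2l; have := @ln_le_subr1 3; lra.
have NM1 : (N%:R : R) <= 2 * M%:R + 1 by rewrite -natrM natr1 ler_nat /M; lia.
have NM2 : (2 * M%:R : R) <= N%:R by rewrite -natrM ler_nat /M; lia.
have lM := lnn_lt M; have lN := lnn_lt N.
have N1 : (1 : R) <= N%:R by rewrite ler1n.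
have lM0 := lnn_ge0 M; have lN0 := lnn_ge0 N.
have e1 : N%:R * L N <= N%:R * (L M + 2) by rewrite ler_wpM2l // ler0n.
have e2 : N%:R * L M <= (2 * M%:R + 1) * L M by rewrite ler_wpM2r.
by lra.
Qed.

(** Replacing floor(N/n) by N/n in ln N! costs at most psi(N) <= 10 N. *)
Lemma mertens N : (0 < N)%N ->
  L N - 1 <= \sum_(1 <= n < N.+1) Lam n / n%:R <= L N + 11.
Proof.
move=> N0; have N0R : (0 : R) < N%:R by rewrite ltr0n.
have N1 : (1 : R) <= N%:R by rewrite ler1n.
have /andP[s1 s2] := stirling N0; have c := chebyshev N; have lN := lnn_lt N.
have e1 : ln_fact N <= N%:R * \sum_(1 <= n < N.+1) Lam n / n%:R.
  rewrite ln_fact_mangoldt mulr_sumr ler_sum_nat // => n /andP[n0 _].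
  rewrite mulrCA ler_wpM2l ?mangoldt_ge0 // ler_pdivlMr ?ltr0n // -natrM ler_nat.
  exact: leq_divM.
have e2 : N%:R * \sum_(1 <= n < N.+1) Lam n / n%:R <= ln_fact N + psi N.
  rewrite ln_fact_mangoldt mulr_sumr -big_split ler_sum_nat //= => n /andP[n0 _].
  rewrite -{3}[Lam n]mulr1 -mulrDr mulrCA ler_wpM2l ?mangoldt_ge0 //.
  rewrite ler_pdivrMr ?ltr0n // natr1 -natrM ler_nat ltnW // ltn_ceil //.
apply/andP; split; rewrite -(ler_pM2l N0R); lra.
Qed.

End Chebyshev.

(** * Selberg's formula *)

Section Selberg.
Variable R : realType.
Local Notation Lam := (mangoldt R).
Local Notation L n := (ln (n%:R : R)).
Local Notation psi := (chebyshev_psi R).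

(** The fourth root makes (1 + ln x)^2 at most 16 sqrt x, so sums of (1 + ln(N/d))^2 over d <= N are
    O(N) without a logarithm. *)
Lemma oneD_ln_le (x : R) : 1 <= x -> 1 + ln x <= 4 * Num.sqrt (Num.sqrt x).
Proof.
move=> x1; set y := Num.sqrt (Num.sqrt x).
have y0 : 0 < y by rewrite !sqrtr_gt0; lra.
have -> : x = y ^+ 4.
  by rewrite (exprM y 2 2) !sqr_sqrtr ?sqrtr_ge0 //; lra.
by rewrite lnXn // -mulr_natr; have := ln_le_subr1 y0; lra.
Qed.

Lemma sum_sqrtV N : \sum_(1 <= d < N.+1) (Num.sqrt d%:R)^-1 <= 2 * Num.sqrt N%:R :> R.
Proof.
elim: N => [|N IH]; first by rewrite big_geq // sqrtr0 mulr0.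
rewrite big_nat_recr //=.
set u := Num.sqrt N%:R in IH *; set v := Num.sqrt N.+1%:R.
have u0 : 0 <= u by exact: sqrtr_ge0.
have v0 : 0 < v by rewrite sqrtr_gt0 ltr0n.
have e : v * v = u * u + 1.
  by rewrite -!expr2 !sqr_sqrtr ?ler0n // natr1.
have uv : u <= v by rewrite ler_sqrt ?ler0n // ler_nat.
suff h : v^-1 <= 2 * (v - u) by lra.
rewrite -div1r ler_pdivrMr //.
by have := sqr_ge0 (v - u); rewrite expr2; lra.
Qed.

Definition psi_err (N : nat) : R := psi N - N%:R.
Local Notation E := psi_err.

Lemma psi_err0 : E 0 = 0. Proof. by rewrite /E psi0 subrr. Qed.

Lemma normr_psi_err N : `|E N| <= 10 * N%:R.
Proof.
have := chebyshev R N; have := psi_ge0 R N; have := ler0n R N.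
by rewrite ler_norml /E; lra.
Qed.

(** With x = N/d and M = floor x the sum is ln M! - x H(M) + (1 + g) M. The shift 1 + g is chosen so
    that the linear terms cancel: up to O(1 + ln M) there remains (M - x)(ln M + g). *)
Lemma psi_err_summatory (g : R) N d : 0 <= g <= 1 -> (0 < d <= N)%N ->
  (forall n, (0 < n)%N -> `|harmonic_sum R n - L n - g| <= n%:R^-1) ->
  `|\sum_(1 <= m < (N %/ d).+1) (psi (N %/ (d * m)) - N%:R / (d * m)%:R + (1 + g))|
    <= 4 * (1 + (L N - L d)).
Proof.
move=> /andP[g0 g1] /andP[d0 dN] hg; set M := (N %/ d)%N.
have M0 : (0 < M)%N by rewrite divn_gt0.
have N0 : (0 < N)%N by apply: leq_trans dN.
have dR : (0 : R) < d%:R by rewrite ltr0n.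
have MR : (1 : R) <= M%:R by rewrite ler1n.
pose x : R := N%:R / d%:R.
have x1 : M%:R <= x by rewrite ler_pdivlMr // -natrM ler_nat leq_divM.
have x2 : x <= M%:R + 1 by rewrite ler_pdivrMr // natr1 -natrM ler_nat ltnW // ltn_ceil.
have -> : \sum_(1 <= m < M.+1) (psi (N %/ (d * m)) - N%:R / (d * m)%:R + (1 + g)) =
   ln_fact R M - x * harmonic_sum R M + (1 + g) * M%:R.
  rewrite big_split /= [X in X + _]big_split /= sumr_const_nat subn1 /= mulr_natr; congr (_ + _ + _).
    by rewrite ln_fact_psi; apply: eq_bigr => m _; rewrite divnMA.
  rewrite sumrN mulr_sumr; congr (- _); apply: eq_bigr => m _.
  by rewrite natrM invfM mulrA.
have lMx : L M <= L N - L d.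
  by rewrite -ln_div ?posrE ?ltr0n // -/x ler_ln ?posrE //; lra.
have /andP[s1 s2] := stirling R M0; have lM0 := lnn_ge0 R M.
have := hg _ M0; rewrite ler_norml => /andP[h1 h2].
set H := harmonic_sum R M in h1 h2 *.
have xM : x * M%:R^-1 <= 2 by rewrite ler_pdivrMr; lra.
have e1 : x * (H - L M - g) <= 2 by apply: le_trans xM; rewrite ler_wpM2l //; lra.
have e2 : - 2 <= x * (H - L M - g).
  by rewrite lerNl -mulrN; apply: le_trans xM; rewrite ler_wpM2l //; lra.
have e3 : 0 <= (x - M%:R) * (L M + g) by rewrite mulr_ge0 //; lra.
have e4 : (x - M%:R) * (L M + g) <= L M + 1.
  have : (x - M%:R) * (L M + g) <= 1 * (L M + g) by rewrite ler_wpM2r //; lra.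
  lra.
by rewrite ler_norml; apply/andP; split; lra.
Qed.

Lemma selberg N : (0 < N)%N ->
  `|E N * L N + \sum_(1 <= k < N.+1) Lam k * E (N %/ k)| <= 150 * N%:R.
Proof.
move=> N0; have [g g01 hg] := euler_mascheroni R.
have N1 : (1 : R) <= N%:R by rewrite ler1n.
pose F k : R := psi (N %/ k) - N%:R / k%:R + (1 + g).
have := tatuzawa_iseki F N0.
set S := (X in X = _) => tz.
(* Each term is at most 4 (1 + ln(N/d))^2 <= 64 sqrt(N/d), and the sum of 1 / sqrt d is at most 2
   sqrt N. *)
have SB : `|S| <= 128 * N%:R.
  rewrite /S (le_trans (ler_norm_sum _ _ _)) //.
  apply: le_trans (_ : \sum_(1 <= d < N.+1) 64 * Num.sqrt N%:R * (Num.sqrt d%:R)^-1 <= _).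
    rewrite ler_sum_nat // => d /andP[d0 dN].
    have dR : (0 : R) < d%:R by rewrite ltr0n.
    have x1 : (1 : R) <= N%:R / d%:R by rewrite ler_pdivlMr // mul1r ler_nat.
    have lx : ln (N%:R / d%:R : R) = L N - L d by rewrite ln_div ?posrE ?ltr0n.
    have l0 : 0 <= L N - L d by rewrite -lx ln_ge0.
    rewrite !normrM (ger0_norm l0).
    have b1 := normr_mobius R d.
    have b2 := psi_err_summatory g01 (_ : (0 < d <= N)%N) hg.
    rewrite d0 in b2; have {}b2 := b2 dN.
    have b3 := oneD_ln_le x1; rewrite lx in b3.
    have e : Num.sqrt (N%:R / d%:R) = Num.sqrt N%:R * (Num.sqrt d%:R)^-1 :> R.
      by rewrite sqrtrM ?ler0n // sqrtrV ?ler0n.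
    rewrite -[X in _ <= X]mulrA -e.
    set y := Num.sqrt (Num.sqrt _) in b3.
    have -> : Num.sqrt (N%:R / d%:R) = y * y :> R by rewrite -expr2 sqr_sqrtr ?sqrtr_ge0.
    apply: le_trans (_ : 1 * (L N - L d) * (4 * (1 + (L N - L d))) <= _).
      apply: ler_pM => //; first by rewrite mulr_ge0.
      by rewrite ler_wpM2r.
    have -> : 64 * (y * y) = (4 * y) * (4 * (4 * y)) by ring.
    rewrite mul1r; apply: ler_pM; rewrite ?mulr_ge0 //; lra.
  rewrite -mulr_sumr.
  apply: le_trans (_ : 64 * Num.sqrt N%:R * (2 * Num.sqrt N%:R) <= _).
    by rewrite ler_wpM2l ?mulr_ge0 ?sqrtr_ge0 ?sum_sqrtV.
  have := sqr_sqrtr (ler0n R N); rewrite expr2 => h; rewrite -[N%:R in X in _ <= X]h; lra.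
have lN := lnn_lt R N; have lN0 := lnn_ge0 R N.
have c := chebyshev R N.
(* The fractional part of N/k. Passing from F to E changes each value by an amount in [0, 2],
   costing at most 2 ln N + 2 psi(N) <= 22 N; thus 150 = 128 + 22. *)
pose D k : R := N%:R / k%:R - (N %/ k)%:R.
have D01 k : (0 < k)%N -> 0 <= D k <= 1.
  move=> k0; have kR : (0 : R) < k%:R by rewrite ltr0n.
  rewrite /D subr_ge0 lerBlDl ler_pdivlMr // ler_pdivrMr // natr1 -!natrM !ler_nat.
  by rewrite leq_divM ltnW // ltn_ceil.
have eF k : F k = E (N %/ k) + (1 + g - D k) by rewrite /F /E /D; lra.
have -> : E N * L N + \sum_(1 <= k < N.+1) Lam k * E (N %/ k) =
   S - L N * (1 + g - D 1%N) - \sum_(1 <= k < N.+1) Lam k * (1 + g - D k).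
  rewrite tz; under [in RHS]eq_bigr => k _ do rewrite eF mulrDr.
  by rewrite big_split /= eF divn1; lra.
have h1 : 0 <= L N * (1 + g - D 1%N) <= L N * 2.
  have := D01 1%N isT => h; rewrite mulr_ge0 //=; last by lra.
  by rewrite ler_wpM2l //; lra.
have h2 : 0 <= \sum_(1 <= k < N.+1) Lam k * (1 + g - D k) <= psi N * 2.
  rewrite /psi mulr_suml; apply/andP; split.
    rewrite big_nat_cond sumr_ge0 // => k /andP[/andP[k0 _] _].
    by have := D01 _ k0 => h; rewrite mulr_ge0 ?mangoldt_ge0 //; lra.
  rewrite ler_sum_nat // => k /andP[k0 _].
  by have := D01 _ k0 => h; rewrite ler_wpM2l ?mangoldt_ge0 //; lra.
move: SB h1 h2; rewrite !ler_norml => /andP[? ?] /andP[? ?] /andP[? ?].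
by apply/andP; split; lra.
Qed.

(** The Dirichlet square of Lambda, which arises when the formula is inserted into itself. *)
Definition mangoldt2 (n : nat) : R :=
  \sum_(1 <= d < n.+1 | (d %| n)%N) Lam d * Lam (n %/ d).

Lemma mangoldt2_ge0 n : 0 <= mangoldt2 n.
Proof. by apply: sumr_ge0 => d _; rewrite mulr_ge0 ?mangoldt_ge0. Qed.

Lemma sum_mangoldt2 N (G : nat -> R) :
  \sum_(1 <= n < N.+1) mangoldt2 n * G n =
  \sum_(1 <= d < N.+1) Lam d * \sum_(1 <= m < (N %/ d).+1) Lam m * G (d * m)%N.
Proof.
under eq_bigr => n _ do rewrite mulr_suml.
rewrite (sum_divisors N (fun d n => Lam d * Lam (n %/ d) * G n)).
apply: eq_big_nat => d /andP[d0 _]; rewrite mulr_sumr; apply: eq_bigr => m _.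
by rewrite mulKn // mulrA.
Qed.

Definition selberg_weight (n : nat) : R := Lam n * L n + mangoldt2 n.

Definition selberg_sum N : R := \sum_(1 <= n < N.+1) selberg_weight n.

(** Partial summation done by induction: one step loses psi(N) (ln(N+1) - ln N), at most 10 by
    Chebyshev. *)
Lemma sum_mangoldt_ln N :
  psi N * L N - 10 * N%:R <= \sum_(1 <= n < N.+1) Lam n * L n <= psi N * L N.
Proof.
elim: N => [|N /andP[IH1 IH2]]; first by rewrite big_geq // psi0; apply/andP; split; lra.
rewrite big_nat_recr //= psiS; case: N IH1 IH2 => [|N] IH1 IH2.
  by rewrite big_geq // psi0 ln1; apply/andP; split; lra.
have /andP[h1 h2] := lnn_step R (ltn0Sn N).
have c := chebyshev R N.+1; have p0 := psi_ge0 R N.+1.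
have n0 : (0 : R) < N.+1%:R by rewrite ltr0n.
have e1 : psi N.+1 * (L N.+2 - L N.+1) <= 10.
  apply: le_trans (_ : (10 * N.+1%:R) * N.+1%:R^-1 <= _).
    apply: ler_pM => //; rewrite subr_ge0 lnn_le //.
  by rewrite mulfK // gt_eqF.
have e2 : 0 <= psi N.+1 * (L N.+2 - L N.+1).
  by rewrite mulr_ge0 // subr_ge0 lnn_le.
have e3 : (N.+2%:R : R) = N.+1%:R + 1 by rewrite natr1.
apply/andP; split; lra.
Qed.

(** Selberg's symmetric formula. In [selberg] the floors sum to ln N! by [ln_fact_mangoldt], and
    Stirling identifies N ln N with ln N! up to O(N). *)
Lemma selberg_sumE N : (0 < N)%N -> `|selberg_sum N - 2 * ln_fact R N| <= 170 * N%:R.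
Proof.
move=> N0; rewrite /selberg_sum big_split /=.
have N1 : (1 : R) <= N%:R by rewrite ler1n.
have -> : \sum_(1 <= n < N.+1) mangoldt2 n = \sum_(1 <= d < N.+1) Lam d * psi (N %/ d).
  have := sum_mangoldt2 N (fun=> 1).
  under eq_bigr do rewrite mulr1. move=> ->; apply: eq_bigr => d _; congr (_ * _).
  by apply: eq_bigr => m _; rewrite mulr1.
have := selberg N0; have /andP[d1 d2] := sum_mangoldt_ln N.
have /andP[s1 s2] := stirling R N0; have lN := lnn_lt R N.
have -> : \sum_(1 <= k < N.+1) Lam k * E (N %/ k) =
  \sum_(1 <= d < N.+1) Lam d * psi (N %/ d) - ln_fact R N.
  rewrite ln_fact_mangoldt -sumrB; apply: eq_bigr => d _; by rewrite mulrBr.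
rewrite /E !ler_norml => /andP[? ?]; apply/andP; split; lra.
Qed.

End Selberg.

(** * Averaging the error term with logarithmic weights *)

Section Selberg2.
Variable R : realType.
Local Notation Lam := (mangoldt R).
Local Notation L n := (ln (n%:R : R)).
Local Notation psi := (chebyshev_psi R).
Local Notation E := (psi_err R).

Lemma abel_sum (A e : nat -> R) N :
  \sum_(1 <= n < N.+1) (A n - A n.-1) * e n =
  \sum_(1 <= n < N.+1) A n * (e n - e n.+1) + A N * e N.+1 - A 0%N * e 1%N.
Proof.
elim: N => [|N IH]; first by rewrite !big_geq //; ring.
by rewrite big_nat_recr //= IH [in RHS]big_nat_recr //=; ring.
Qed.

Lemma harmonic_sum_le N : (0 < N)%N -> harmonic_sum R N <= L N + 1.
Proof.
case: N => // N _; elim: N => [|N IH].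
  by rewrite /harmonic_sum big_nat1 ln1 invr1; lra.
rewrite harmonic_sumS; have /andP[h1 h2] := lnn_step R (ltn0Sn N).
set u := _^-1 in h1 *; lra.
Qed.

Lemma harmonic_sum_ge N : L N.+1 <= harmonic_sum R N.
Proof.
elim: N => [|N IH]; first by rewrite ln1 /harmonic_sum big_geq.
rewrite harmonic_sumS; have /andP[h1 h2] := lnn_step R (ltn0Sn N).
set u := _^-1 in h2 *; lra.
Qed.

Lemma sum_divn_le (f : nat -> R) (c : R) N : (0 < N)%N -> 0 <= c ->
  (forall n, f n <= c * n%:R) ->
  \sum_(1 <= n < N.+1) f (N %/ n)%N <= c * N%:R * (1 + L N).
Proof.
move=> N0 c0 fc.
apply: le_trans (_ : \sum_(1 <= n < N.+1) c * N%:R * n%:R^-1 <= _).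
  rewrite ler_sum_nat // => n /andP[n0 _]; apply: le_trans (fc _) _.
  rewrite -mulrA ler_wpM2l // ler_pdivlMr ?ltr0n // -natrM ler_nat.
  exact: leq_divM.
rewrite -mulr_sumr ler_wpM2l ?mulr_ge0 //.
by have := harmonic_sum_le N0; rewrite /harmonic_sum; lra.
Qed.

(** Partial summation against A(n) = O(n), the error in Selberg's formula. The variation of |E(N/n)|
    is dominated by that of the monotone function T = psi + id, and summing n (T(N/n) - T(N/(n+1)))
    by parts gives the sum of T(N/n), which is O(N (1 + ln N)). The boundary term vanishes because
    [N %/ N.+1] is 0. *)
Lemma selberg_weight_smooth N : (0 < N)%N ->
  \sum_(1 <= n < N.+1) selberg_weight R n * `|E (N %/ n)%N| <=
  2 * (\sum_(1 <= n < N.+1) L n * `|E (N %/ n)%N|) + 1870 * N%:R * (1 + L N).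
Proof.
move=> N0.
pose A n : R := selberg_sum R n - 2 * ln_fact R n.
pose e n : R := `|E (N %/ n)%N|.
pose T n : R := psi n + n%:R.
have -> : \sum_(1 <= n < N.+1) selberg_weight R n * e n =
   2 * (\sum_(1 <= n < N.+1) L n * e n) + \sum_(1 <= n < N.+1) (A n - A n.-1) * e n.
  rewrite mulr_sumr -big_split; apply: eq_big_nat => /= n /andP[n0 _].
  case: n n0 => // n _ /=; rewrite /A ln_factS /selberg_sum big_nat_recr //=; ring.
have A0 : A 0%N = 0 by rewrite /A /selberg_sum /ln_fact !big_geq // mulr0 subrr.
have TN : T (N %/ N.+1)%N = 0 by rewrite divn_small // /T psi0 addr0.
have eN : e N.+1 = 0 by rewrite /e divn_small // psi_err0 normr0.
rewrite lerD2l abel_sum A0 mul0r subr0 eN mulr0 addr0.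
have eT n : (0 < n)%N -> `|e n - e n.+1| <= T (N %/ n)%N - T (N %/ n.+1)%N.
  move=> n0; apply: le_trans (ler_dist_dist _ _) _; rewrite /psi_err /T.
  have h : (N %/ n.+1 <= N %/ n)%N by exact: leq_div2l.
  have h1 := psi_le R h; have h2 : ((N %/ n.+1)%:R : R) <= (N %/ n)%:R by rewrite ler_nat.
  by rewrite ler_norml; apply/andP; split; lra.
apply: le_trans (_ : \sum_(1 <= n < N.+1) 170 * (n%:R * (T (N %/ n)%N - T (N %/ n.+1)%N)) <= _).
  rewrite ler_sum_nat // => n /andP[n0 _]; rewrite mulrA.
  apply: le_trans (ler_norm _) _; by rewrite normrM ler_pM // ?selberg_sumE // eT.
rewrite -mulr_sumr.
have := abel_sum (fun n => n%:R) (fun n => T (N %/ n)%N) N.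
rewrite /= TN mulr0 mul0r subr0 addr0 => <-.
have -> : \sum_(1 <= n < N.+1) (n%:R - n.-1%:R) * T (N %/ n)%N = \sum_(1 <= n < N.+1) T (N %/ n)%N.
  apply: eq_big_nat => n /andP[n0 _]; case: n n0 => // n _.
  by rewrite -natr1 addrAC subrr add0r mul1r.
have : \sum_(1 <= n < N.+1) T (N %/ n)%N <= 11 * N%:R * (1 + L N).
  apply: sum_divn_le => // n; rewrite /T; have := chebyshev R n; lra.
lra.
Qed.

(** Multiply the formula at N by ln N, write ln N = ln m + ln(N/m) in the m-th term, and apply the
    formula at N/m to E(N/m) ln(N/m). The resulting sums with Lambda ln and Lambda * Lambda have
    opposite signs, so absolute values combine them into [selberg_weight]. *)
Lemma psi_err_sqr N : (0 < N)%N ->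
  `|E N| * (L N * L N) <=
   \sum_(1 <= n < N.+1) selberg_weight R n * `|E (N %/ n)%N| + 2000 * N%:R * (1 + L N).
Proof.
move=> N0; have lN0 := lnn_ge0 R N.
have N1 : (1 : R) <= N%:R by rewrite ler1n.
pose r n : R := E n * L n + \sum_(1 <= k < n.+1) Lam k * E (n %/ k)%N.
have rb n : (0 < n)%N -> `|r n| <= 150 * n%:R by exact: selberg.
(* The defect of ln(N/m) when N/m is rounded down. It is at most 1 / [(N %/ m)], so rho times E(N/m)
   stays below 10. *)
pose rho m : R := L N - L m - L (N %/ m)%N.
have rhob m : (0 < m <= N)%N -> 0 <= rho m <= (N %/ m)%:R^-1.
  move=> /andP[m0 mN]; set M := (N %/ m)%N.
  have M0 : (0 < M)%N by rewrite divn_gt0.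
  have -> : rho m = L N - L (m * M)%N by rewrite lnnM // /rho; lra.
  rewrite subr_ge0 lnn_le ?muln_gt0 ?m0 //=; last by rewrite mulnC leq_divM.
  have mM : (0 : R) < (m * M)%:R by rewrite ltr0n muln_gt0 m0.
  rewrite -ln_div ?posrE ?ltr0n ?muln_gt0 ?m0 //.
  have q0 : (0 : R) < N%:R / (m * M)%:R by rewrite divr_gt0 // ltr0n.
  apply: le_trans (ln_le_subr1 q0) _.
  rewrite lerBlDr ler_pdivrMr // mulrDl mul1r natrM [m%:R * _]mulrC mulKf ?gt_eqF ?ltr0n //.
  by rewrite -natrM -natrD ler_nat addnC -mulSnr mulnC ltnW // mulnC ltn_ceil.
have e1 : E N * (L N * L N) = r N * L N
   - \sum_(1 <= m < N.+1) Lam m * L m * E (N %/ m)%N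
   - \sum_(1 <= m < N.+1) Lam m * (r (N %/ m)%N + rho m * E (N %/ m)%N)
   + \sum_(1 <= n < N.+1) mangoldt2 R n * E (N %/ n)%N.
  rewrite sum_mangoldt2.
  have -> : r N * L N = E N * (L N * L N) + (\sum_(1 <= k < N.+1) Lam k * E (N %/ k)%N) * L N.
    by rewrite /r; ring.
  rewrite -!addrA -[LHS]addr0; congr (_ + _).
  rewrite mulr_suml -!sumrN -!big_split /= big1_seq // => m.
  rewrite mem_index_iota => /andP[_ /andP[m0 _]].
  under [X in _ + (_ + Lam m * X)]eq_bigr do rewrite divnMA.
  by rewrite /rho /r; ring.
have e2 : `|r N * L N| <= 150 * N%:R * L N.
  by rewrite normrM (ger0_norm lN0) ler_wpM2r // rb.
have e3 : `|\sum_(1 <= m < N.+1) Lam m * (r (N %/ m)%N + rho m * E (N %/ m)%N)| <=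
    150 * N%:R * (L N + 11) + 100 * N%:R.
  apply: le_trans (ler_norm_sum _ _ _) _.
  apply: le_trans (_ : \sum_(1 <= m < N.+1) (150 * N%:R * (Lam m / m%:R) + 10 * Lam m) <= _).
    rewrite ler_sum_nat // => m /andP[m0 mN].
    rewrite normrM (ger0_norm (mangoldt_ge0 R m)).
    have -> : 150 * N%:R * (Lam m / m%:R) + 10 * Lam m = Lam m * (150 * (N%:R / m%:R) + 10) by ring.
    rewrite ler_wpM2l ?mangoldt_ge0 //; apply: le_trans (ler_normD _ _) _.
    have M0 : (0 < N %/ m)%N by rewrite divn_gt0.
    apply: lerD.
      apply: le_trans (rb _ M0) _; rewrite ler_pM2l // ler_pdivlMr ?ltr0n // -natrM ler_nat.
      exact: leq_divM.
    rewrite normrM; have := rhob m; rewrite m0 => /(_ mN) /andP[p0 p1].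
    rewrite (ger0_norm p0).
    apply: le_trans (_ : (N %/ m)%:R^-1 * (10 * (N %/ m)%:R) <= _).
      by rewrite ler_pM // normr_psi_err.
    by rewrite mulrC mulfK // gt_eqF // ltr0n.
  rewrite big_split /= -!mulr_sumr; have /andP[_ h] := mertens R N0.
  rewrite lerD //; first by rewrite ler_wpM2l // mulr_ge0.
  by have := chebyshev R N; rewrite /chebyshev_psi; lra.
have -> : `|E N| * (L N * L N) = `|E N * (L N * L N)|.
  by rewrite normrM [X in _ = _ * X]ger0_norm // mulr_ge0.
rewrite e1.
have e4 : `|\sum_(1 <= n < N.+1) mangoldt2 R n * E (N %/ n)%N
   - \sum_(1 <= m < N.+1) Lam m * L m * E (N %/ m)%N| <=
   \sum_(1 <= n < N.+1) selberg_weight R n * `|E (N %/ n)%N|.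
  rewrite -sumrB; apply: le_trans (ler_norm_sum _ _ _) _.
  apply: ler_sum => n _; rewrite -mulrBl normrM ler_wpM2r // /selberg_weight.
  apply: le_trans (ler_normB _ _) _.
  rewrite !ger0_norm ?mangoldt2_ge0 // ?mulr_ge0 ?mangoldt_ge0 ?lnn_ge0 //; lra.
set x := r N * L N in e2 *; set y := \sum_(1 <= m < _) Lam m * L m * _ in e4 *.
set z := \sum_(1 <= m < _) Lam m * _ in e3 *; set w := \sum_(1 <= n < _) mangoldt2 R n * _ in e4 *.
set S := \sum_(1 <= n < _) _ in e4 *.
move: e2 e3 e4; rewrite !ler_norml => /andP[? ?] /andP[? ?] /andP[? ?].
by apply/andP; split; lra.
Qed.

Lemma psi_err_average N : (0 < N)%N ->
  `|E N| * (L N * L N) <=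
   2 * (\sum_(1 <= n < N.+1) L n * `|E (N %/ n)%N|) + 4000 * N%:R * (1 + L N).
Proof.
move=> N0; have := psi_err_sqr N0; have := selberg_weight_smooth N0.
have : 0 <= N%:R * (1 + L N) by rewrite mulr_ge0 // addr_ge0 // lnn_ge0.
lra.
Qed.

End Selberg2.

(** * Stretches of small error *)

Section GoodSpot.
Variable R : realType.
Local Notation Lam := (mangoldt R).
Local Notation L n := (ln (n%:R : R)).
Local Notation psi := (chebyshev_psi R).
Local Notation E := (psi_err R).

Lemma lnn_unbounded (x : R) : exists2 K, (0 < K)%N & forall n, (K <= n)%N -> x <= L n.
Proof.
exists (Num.trunc (expR x)).+1 => // n Kn.
have n0 : (0 < n)%N by apply: leq_trans Kn.
rewrite -(expRK x) ler_ln ?posrE ?expR_gt0 ?ltr0n //.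
apply: le_trans (_ : (Num.trunc (expR x)).+1%:R <= _); last by rewrite ler_nat.
exact/ltW/truncnS_gt.
Qed.

(** An upper bound of Brun-Titchmarsh type, twice the expected main term, obtained by discarding the
    nonnegative [mangoldt2] from Selberg's formula. The 512 is 170 * 3 from the errors at m and m0
    plus 2 from replacing ln n by ln m0 + 1. *)
Lemma psi_short m0 m : (0 < m0)%N -> (m0 <= m <= 2 * m0)%N ->
  (psi m - psi m0) * L m0 <= 2 * (m%:R - m0%:R) * L m0 + 512 * m0%:R.
Proof.
move=> p0 /andP[h1 h2]; have p1 : (0 < m)%N by apply: leq_trans h1.
have := selberg_sumE R p0; have := selberg_sumE R p1.
have cut (F : nat -> R) : \sum_(1 <= n < m.+1) F n - \sum_(1 <= n < m0.+1) F n =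
    \sum_(m0.+1 <= n < m.+1) F n.
  by rewrite (big_cat_nat (n := m0.+1)) //= [X in X - _]addrC addrK.
have e1 : (psi m - psi m0) * L m0 <= selberg_sum R m - selberg_sum R m0.
  rewrite /selberg_sum /chebyshev_psi !cut mulr_suml ler_sum_nat // => n /andP[n1 _].
  apply: le_trans (_ : Lam n * L n <= _); last by rewrite lerDl mangoldt2_ge0.
  by rewrite ler_wpM2l ?mangoldt_ge0 // lnn_le // ltnW.
have lm : L m <= L m0 + 1.
  apply: le_trans (lnn_le R p1 h2) _; rewrite lnnM // addrC lerD2l.
  have := @ln_le_subr1 R 2; lra.
have e2 : ln_fact R m - ln_fact R m0 <= (m%:R - m0%:R) * (L m0 + 1).
  rewrite /ln_fact cut.
  apply: le_trans (_ : \sum_(m0.+1 <= n < m.+1) (L m0 + 1) <= _).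
    rewrite ler_sum_nat // => n /andP[n1 n2]; apply: le_trans lm.
    by rewrite lnn_le // (leq_ltn_trans _ n1).
  by rewrite sumr_const_nat subSS -natrB // mulr_natl.
have e3 : (m%:R : R) <= 2 * m0%:R by rewrite -natrM ler_nat.
rewrite !ler_norml => /andP[? ?] /andP[? ?]; lra.
Qed.

(** Monotonicity of psi lets E drop by at most m - m0; [psi_short] limits its rise to the same
    amount plus a small error. *)
Lemma psi_err_short (eps : R) : 0 < eps -> exists2 M, (0 < M)%N &
  forall m0 m, (M <= m0)%N -> (m0 <= m <= 2 * m0)%N ->
    `|E m - E m0| <= m%:R - m0%:R + eps * m0%:R.
Proof.
move=> e0; have [M M0 hM] := lnn_unbounded (512 / eps + 1).
exists M => // m0 m Mm h.
have p0 : (0 < m0)%N by apply: leq_trans Mm.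
have := psi_short p0 h; case/andP: h => h1 h2; have := hM _ Mm => l1.
have q0 : 0 < 512 / eps by rewrite divr_gt0 ?ltr0n.
have l0 : 0 < L m0 by lra.
have m0R : (0 : R) < m0%:R by rewrite ltr0n.
have l2 : 512 <= eps * L m0 by rewrite mulrC -ler_pdivrMr //; lra.
move=> h.
have {}h : psi m - psi m0 <= 2 * (m%:R - m0%:R) + eps * m0%:R.
  rewrite -(ler_pM2r l0); apply: le_trans h _; rewrite [X in _ <= X]mulrDl lerD2l.
  by rewrite mulrAC ler_pM2r.
have h3 := psi_le R h1; have h4 : (m0%:R : R) <= m%:R by rewrite ler_nat.
have h5 : 0 <= eps * m0%:R by rewrite mulr_ge0 // ltW.
by rewrite /psi_err ler_norml; apply/andP; split; lra.
Qed.

Definition psi_err_mean (N : nat) : R :=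
  \sum_(1 <= m < N.+1) E m * (m%:R^-1 - m.+1%:R^-1).

(** Abel summation turns the psi part into Mertens' sum and the linear part into a harmonic sum;
    their logarithms cancel. *)
Lemma psi_err_mean_bounded N : (0 < N)%N -> `|psi_err_mean N| <= 13.
Proof.
move=> N0.
have h1 : \sum_(1 <= m < N.+1) psi m * (m%:R^-1 - m.+1%:R^-1) =
    \sum_(1 <= n < N.+1) Lam n / n%:R - psi N * N.+1%:R^-1.
  have := abel_sum psi (fun n => n%:R^-1) N; rewrite psi0 mul0r subr0 => h.
  apply: (addIr (psi N / N.+1%:R)); rewrite -h subrK.
  apply: eq_big_nat => n /andP[n0 _]; congr (_ * _).
  by case: n n0 => // n _; rewrite psiS /= addrC addKr.
have h2 : \sum_(1 <= m < N.+1) (m%:R : R) * (m%:R^-1 - m.+1%:R^-1) = harmonic_sum R N.+1 - 1.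
  rewrite /harmonic_sum [in RHS]big_nat_recl // invr1 addrC addKr.
  apply: eq_big_nat => m /andP[m0 _]; have m0R : (0 : R) < m%:R by rewrite ltr0n.
  by rewrite -natr1; field; rewrite !gt_eqF //; lra.
have e : psi_err_mean N = \sum_(1 <= n < N.+1) Lam n / n%:R - psi N * N.+1%:R^-1
    - (harmonic_sum R N.+1 - 1).
  by rewrite -h1 -h2 -sumrB; apply: eq_bigr => m _; rewrite mulrBl.
have /andP[m1 m2] := mertens R N0.
have /andP[l1 l2] := lnn_step R N0.
have c1 : 0 <= psi N * N.+1%:R^-1 by rewrite mulr_ge0 ?psi_ge0 // invr_ge0.
have c2 : psi N * N.+1%:R^-1 <= 10.
  rewrite ler_pdivrMr //; apply: le_trans (chebyshev R N) _.
  by rewrite ler_pM2l // ler_nat.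
have k1 := harmonic_sum_le R (ltn0Sn N); have k2 := harmonic_sum_ge R N.+1.
have k3 := lnn_le R (ltn0Sn N) (leqnSn N.+1); have k4 := lnn_le R N0 (leqnSn N).
have k5 : (N%:R : R)^-1 <= 1 by rewrite invf_le1 ?ler1n ?ltr0n.
set u := _^-1 in l2 k5; set v := psi N * _ in e c1 c2.
have l3 : L N.+1 - L N <= u by [].
rewrite e ler_norml; apply/andP; split; lra.
Qed.

(** If |E(m)| > delta m on the whole window, E cannot change sign there, because its steps are too
    short to cross the gap. Then the terms of [psi_err_mean] add up to at least delta (ln b - ln a -
    2), beyond 26 = 2 * 13. *)
Lemma psi_err_spot (delta : R) : 0 < delta -> exists2 M, (0 < M)%N &
  forall a b, (M <= a)%N -> 26 / delta + 2 < L b - L a ->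
    exists2 m0, (a < m0 <= b)%N & `|E m0| <= delta * m0%:R.
Proof.
move=> d0; have d20 : 0 < delta / 2 by lra.
have [M1 M10 hM1] := psi_err_short d20.
exists (maxn M1 (Num.trunc (2 / delta)).+1) => [|a b].
  by rewrite leq_max M10.
rewrite geq_max => /andP[aM1 aM2] hab.
have a0 : (0 < a)%N by apply: leq_trans M10 aM1.
have q0 : 0 < 26 / delta by rewrite divr_gt0 ?ltr0n.
have ab : (a <= b)%N.
  rewrite leqNgt; apply/negP => ba; case: (posnP b) => b0.
    have lb : L b = 0 by rewrite b0 ln0.
    by have := lnn_ge0 R a; lra.
  by have := lnn_le R b0 (ltnW ba); lra.
have aR : 2 / delta <= a%:R.
  by apply/ltW/(lt_le_trans (truncnS_gt _)); rewrite ler_nat.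
apply: contrapT => H.
have big m : (a < m <= b)%N -> delta * m%:R < `|E m|.
  by move=> h; rewrite ltNge; apply/negP => h'; apply: H; exists m.
have step m : (a < m < b)%N -> (0 < E m) = (0 < E m.+1).
  move=> /andP[am mb].
  have mR : 2 / delta <= m%:R by apply: le_trans aR _; rewrite ler_nat ltnW.
  have m1 : 1 <= delta / 2 * m%:R.
    move: mR; rewrite ler_pdivrMr // => ?; lra.
  have := hM1 m m.+1 (leq_trans aM1 (ltnW am)); rewrite leqnSn /=.
  move=> /(_ ltac:(lia)); rewrite -natr1 => h.
  have b1 : delta * m%:R < `|E m| by apply: big; rewrite am ltnW.
  have b2 : delta * m.+1%:R < `|E m.+1| by apply: big; rewrite ltnS (ltnW am).
  rewrite -natr1 in b2; move: h; rewrite ler_norml => /andP[h1 h2].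
  case: (ltrP 0 (E m)) b1 => s1; rewrite ?(gtr0_norm s1) ?(ler0_norm s1) => b1;
  case: (ltrP 0 (E m.+1)) b2 => s2; rewrite ?(gtr0_norm s2) ?(ler0_norm s2) => b2 //; lra.
have sign m : (a < m <= b)%N -> (0 < E m) = (0 < E a.+1).
  move=> /andP[am mb]; rewrite -(subnKC am); move: mb; rewrite -{1}(subnKC am).
  elim: (m - a.+1)%N => [|k IH]; first by rewrite addn0.
  by rewrite addnS => h; rewrite -step ?IH // ?(ltnW h) // h andbT addSn leq_addr.
(* The summand |E(m)| / (m (m+1)) exceeds delta / (m+1), which is compared with a telescoping
   difference of logarithms. The shift from a to a + 2 is the reason for the 2 in the length of the
   window. *)
have tot : delta * (L b.+2 - L a.+2) <= `|psi_err_mean b - psi_err_mean a|.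
  have -> : psi_err_mean b - psi_err_mean a =
      \sum_(a.+1 <= m < b.+1) E m * (m%:R^-1 - m.+1%:R^-1).
    by rewrite /psi_err_mean (big_cat_nat (n := a.+1)) //= addrAC subrr add0r.
  have tel : \sum_(a.+1 <= m < b.+1) delta * (L m.+2 - L m.+1) = delta * (L b.+2 - L a.+2).
    by rewrite -mulr_sumr telescope_sumr.
  have term m : (a < m <= b)%N ->
      delta * (L m.+2 - L m.+1) <= `|E m| * (m%:R^-1 - m.+1%:R^-1).
    move=> h; have bm := big _ h; case/andP: h => am _.
    have m0 : (0 < m)%N by apply: leq_trans am.
    have m0R : (0 : R) < m%:R by rewrite ltr0n.
    have /andP[_ l2] := lnn_step R (ltn0Sn m).
    have e : (m%:R^-1 - m.+1%:R^-1 : R) = m%:R^-1 * m.+1%:R^-1.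
      by rewrite -natr1; field; rewrite !gt_eqF //; lra.
    rewrite e mulrA; apply: ler_pM; rewrite ?(ltW d0) // ?subr_ge0 ?lnn_le //.
    by rewrite ler_pdivlMr // ltW.
  case s : (0 < E a.+1).
    apply: le_trans (ler_norm _); rewrite -tel ler_sum_nat // => m h.
    have sm := sign m h; rewrite s in sm; apply: le_trans (term m h) _.
    by rewrite gtr0_norm.
  rewrite -normrN; apply: le_trans (ler_norm _); rewrite -sumrN -tel ler_sum_nat // => m h.
  have sm := sign m h; rewrite s in sm; apply: le_trans (term m h) _.
  by rewrite -mulNr ler0_norm // leNgt sm.
have b0 : (0 < b)%N by apply: leq_trans ab.
have w1 := psi_err_mean_bounded a0; have w2 := psi_err_mean_bounded b0.
have w3 := ler_normB (psi_err_mean b) (psi_err_mean a).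
have l1 : L b <= L b.+2 by rewrite lnn_le // ltnW.
have l2 : L a.+2 <= L a + 2.
  apply: le_trans (_ : L (3 * a)%N <= _); first by rewrite lnn_le // -addn2 mulSn leq_add2l leq_pmulr.
  rewrite lnnM // addrC lerD2l; have := @ln_le_subr1 R 3; lra.
have : delta * (26 / delta) < delta * (L b.+2 - L a.+2) by rewrite ltr_pM2l //; lra.
have -> : delta * (26 / delta) = 26 by rewrite mulrC divfK // gt_eqF.
lra.
Qed.

End GoodSpot.

(** * The saving in one logarithmic window *)

Section Contraction.
Variable R : realType.
Local Notation L n := (ln (n%:R : R)).
Local Notation psi := (chebyshev_psi R).
Local Notation E := (psi_err R).

(** Alpha is split in thirds: one for |E(m0)|, one for the length m - m0 <= m0 / q, one for the
    error of [psi_err_short]. The factor 2 in [m0 * (2 * y)] leaves room for the stretch above m0,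
    so that every n with N/n in it is at least y. *)
Lemma psi_err_plateau (alpha : R) : 0 < alpha -> exists q K M : nat,
  [/\ (0 < q)%N, (1 < K)%N, (0 < M)%N & forall N y, (0 < y)%N -> (M * (K * y) <= N)%N ->
    exists2 m0, (N < m0 * (K * y))%N /\ (m0 * (2 * y) <= N)%N &
      forall m, (m0 <= m)%N -> (m * q <= m0 * q.+1)%N -> `|E m| <= alpha * m%:R].
Proof.
move=> a0; have d0 : 0 < alpha / 3 by lra.
have [M1 M10 hM1] := psi_err_spot d0.
have [M2 M20 hM2] := psi_err_short d0.
pose q := (Num.trunc (3 / alpha)).+1.
(* Since a K <= 4 b, the window has logarithmic length at least ln K - ln 4, and ln 4 <= 3. *)
have [K1 K10 hK1] := lnn_unbounded (26 / (alpha / 3) + 6).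
exists q, (K1 + 2)%N, (maxn M1 M2); split => //.
- lia.
- by rewrite leq_max M10.
set K := (K1 + 2)%N => N y y0 MN.
have K0 : (0 < K)%N by rewrite /K; lia.
pose a := (N %/ (K * y))%N; pose b := (N %/ (2 * y))%N.
have aM : (maxn M1 M2 <= a)%N by rewrite leq_divRL // muln_gt0 K0.
move: (aM); rewrite geq_max => /andP[aM1 aM2].
have a1 : (0 < a)%N by apply: leq_trans aM1.
have ab : (a <= b)%N by apply: leq_div2l; rewrite ?muln_gt0 //= leq_mul2r /K; lia.
have b1 : (0 < b)%N by apply: leq_trans ab.
have hl : (a * K <= 4 * b)%N.
  have h1 : (a * (K * y) <= N)%N by exact: leq_divM.
  have h2 : (N < b.+1 * (2 * y))%N by rewrite ltn_ceil // muln_gt0.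
  suff : (a * K < b.+1 * 2)%N by lia.
  by rewrite -(ltn_pmul2r y0) -!mulnA (leq_ltn_trans h1).
have [|m0 /andP[am0 m0b] hm0] := hM1 a b aM1.
  have := lnn_le R (_ : (0 < a * K)%N) hl; rewrite muln_gt0 a1 K0 => /(_ isT).
  rewrite !lnnM //; have := @ln_le_subr1 R 4; have := hK1 K (leq_addr _ _).
  by move=> h1 /(_ (ltr0n _ 4)) h2 h3; lra.
have m00 : (0 < m0)%N by apply: leq_trans am0.
exists m0.
  split; first by move: am0; rewrite ltn_divLR // muln_gt0 K0.
  by move: m0b; rewrite leq_divRL // muln_gt0.
move=> m m0m mq.
have m2 : (m <= 2 * m0)%N.
  rewrite -(@leq_pmul2r q) //; apply: leq_trans mq _.
  by rewrite -mulnA mulnCA leq_mul2l mul2n -addnn -addn1 leq_add2l orbT.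
have := hM2 m0 m (leq_trans aM2 (ltnW am0)); rewrite m0m m2 => /(_ isT) h1.
have h2 : (m%:R - m0%:R : R) <= alpha / 3 * m0%:R.
  have qR : 3 / alpha <= q%:R by exact/ltW/truncnS_gt.
  have q0 : (0 : R) < q%:R by rewrite ltr0n.
  have h : (m%:R : R) * q%:R <= m0%:R * (q%:R + 1) by rewrite natr1 -!natrM ler_nat.
  have h3 : 1 <= alpha / 3 * q%:R by move: qR; rewrite ler_pdivrMr // => ?; lra.
  rewrite -(ler_pM2r q0).
  have : m0%:R * 1 <= m0%:R * (alpha / 3 * q%:R) by rewrite ler_wpM2l.
  lra.
have h3 : (m0%:R : R) <= m%:R by rewrite ler_nat.
have h4 : alpha * m0%:R <= alpha * m%:R by rewrite ler_pM2l.
have := ler_normD (E m - E m0) (E m0); rewrite subrK; lra.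
Qed.

Lemma sum_window_invr y z : (0 < y <= z)%N ->
  \sum_(y <= n < z) (n%:R : R)^-1 <= L z - L y + y%:R^-1 - z%:R^-1.
Proof.
move=> /andP[y0 yz]; rewrite -(subnKC yz); elim: (z - y)%N => [|k IH].
  by rewrite addn0 big_geq // subrr add0r subrr.
rewrite addnS big_nat_recr ?leq_addr //=.
have k0 : (0 < y + k)%N by rewrite addn_gt0 y0.
have /andP[h1 h2] := lnn_step R k0.
by set u := _^-1 in h1 *; set v := (y + k)%:R^-1 in IH *; lra.
Qed.

Lemma sum_window_le (c : R) N y z : 0 <= c -> (0 < y <= z)%N ->
  (forall n, (y <= n < z)%N -> `|E (N %/ n)%N| <= c * (N %/ n)%:R) ->
  \sum_(y <= n < z) `|E (N %/ n)%N| <= c * N%:R * \sum_(y <= n < z) n%:R^-1.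
Proof.
move=> c0 /andP[y0 yz] h; rewrite mulr_sumr ler_sum_nat // => n hn.
have n0 : (0 < n)%N by case/andP: hn => hn _; apply: leq_trans hn.
apply: le_trans (h n hn) _; rewrite -mulrA ler_wpM2l // ler_pdivlMr ?ltr0n //.
by rewrite -natrM ler_nat leq_divM.
Qed.

(* The stretch given by [psi_err_plateau], seen through [m = N / n], has
   logarithmic length of order [1 / q]; this is where the gain [tau] comes from. *)
Lemma psi_err_window (alpha : R) : 0 < alpha -> exists K Y M (tau : R),
  [/\ (1 < K)%N, (0 < M)%N, 0 < tau & forall beta (N0 : nat), alpha <= beta ->
    (forall n, (N0 <= n)%N -> `|E n| <= beta * n%:R) ->
    forall N y, (Y <= y)%N -> (maxn N0 M * (K * y) <= N)%N ->
      \sum_(y <= n < K * y) `|E (N %/ n)%N| <= beta * N%:R * (L K - tau)].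
Proof.
move=> a0; have a20 : 0 < alpha / 2 by lra.
have [q [K [M [q0 K1 M0 hM]]]] := psi_err_plateau a20.
(* The n of the stretch carry harmonic mass at least 4 tau. Halving the bound there gains 2 tau, the
   boundary term 1/y of [sum_window_invr] costs at most tau, and tau remains. *)
pose tau : R := (8 * q.+1%:R)^-1.
have t0 : 0 < tau by rewrite invr_gt0 mulr_gt0.
exists K, (8 * q.+1)%N, M, tau; split=> // beta N0 ab hb N y Yy hN.
have y0 : (0 < y)%N by apply: leq_trans Yy.
have K0 : (0 < K)%N by apply: ltnW.
have Ky0 : (0 < K * y)%N by rewrite muln_gt0 K0.
have [|m0 [h1 h2] h3] := hM N y y0.
  by apply: leq_trans hN; rewrite leq_mul2r leq_maxr orbT.
have m00 : (0 < m0)%N by case: m0 h1 {h2 h3}.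
have N1 : (0 < N)%N by apply: leq_trans hN; rewrite muln_gt0 leq_max M0 orbT.
(* For n1 < n <= n2 the quotient [N %/ n] lies in the stretch found around m0. *)
pose n1 := ((N * q) %/ (m0 * q.+1))%N; pose n2 := (N %/ m0)%N.
have mq0 : (0 < m0 * q.+1)%N by rewrite muln_gt0 m00.
have yn1 : (y <= n1)%N.
  rewrite leq_divRL //; apply: leq_trans (_ : m0 * (2 * y) * q <= _)%N; last by rewrite leq_mul2r h2 orbT.
  nia.
have n12 : (n1 <= n2)%N.
  rewrite leq_divRL //; have := leq_divM (N * q) (m0 * q.+1); rewrite -/n1 => h.
  have : (n1 * m0 * q.+1 <= N * q.+1)%N.
    by apply: leq_trans (_ : N * q <= _)%N; [rewrite -mulnA | rewrite leq_mul2l leqnSn orbT].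
  by rewrite leq_pmul2r.
have n2K : (n2 < K * y)%N by rewrite ltn_divLR // mulnC.
have b0 : 0 < beta by apply: lt_le_trans ab.
have hbn n : (0 < n < K * y)%N -> `|E (N %/ n)%N| <= beta * (N %/ n)%:R.
  move=> /andP[n0 nK]; apply: hb.
  apply: leq_trans (leq_div2l _ n0 (ltnW nK)).
  rewrite leq_divRL //; apply: leq_trans hN; by rewrite leq_mul2r leq_maxl orbT.
have good n : (n1.+1 <= n < n2.+1)%N -> `|E (N %/ n)%N| <= beta / 2 * (N %/ n)%:R.
  move=> /andP[nn1 nn2]; have n0 : (0 < n)%N by apply: leq_trans nn1.
  apply: le_trans (h3 _ _ _) _.
  - by rewrite leq_divRL // mulnC -leq_divRL.
  - move: nn1; rewrite ltn_divLR // => hn; rewrite -(leq_pmul2r n0).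
    have h := leq_divM N n.
    apply: leq_trans (_ : N * q <= _)%N; first by rewrite mulnAC leq_mul2r h orbT.
    by rewrite ltnW // [X in (_ < X)%N]mulnC.
  - by rewrite ler_wpM2r //; lra.
have n1z : (y <= n1.+1 <= n2.+1)%N by rewrite ltnS n12 ltnW.
rewrite (big_cat_nat (n := n1.+1)) //=; last 2 first.
- by rewrite ltnW.
- exact: leq_ltn_trans n2K.
rewrite (big_cat_nat (n := n2.+1) (m := n1.+1)) //=.
have s1 := @sum_window_le beta N y n1.+1 (ltW b0).
have s2 := @sum_window_le (beta / 2) N n1.+1 n2.+1 (ltac:(lra)).
have s3 := @sum_window_le beta N n2.+1 (K * y) (ltW b0).
rewrite y0 (leqW yn1) in s1; have {}s1 := s1 isT.
rewrite /= ltnS n12 in s2; have {}s2 := s2 isT good.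
rewrite /= n2K in s3; have {}s3 := s3 isT.
have {}s1 : \sum_(y <= n < n1.+1) `|E (N %/ n)%N| <=
    beta * N%:R * (\sum_(y <= n < n1.+1) n%:R^-1).
  apply: s1 => n /andP[yn nn1]; apply: hbn; rewrite (leq_trans y0 yn) /=.
  by apply: leq_ltn_trans n2K; apply: leq_trans n12; rewrite -ltnS.
have {}s3 : \sum_(n2.+1 <= n < K * y) `|E (N %/ n)%N| <=
    beta * N%:R * (\sum_(n2.+1 <= n < K * y) n%:R^-1).
  by apply: s3 => n /andP[nn2 nK]; apply: hbn; rewrite nK (leq_trans _ nn2).
have tot := @sum_window_invr y (K * y)%N.
rewrite y0 leq_pmull //= in tot; have {}tot := tot isT.
rewrite (big_cat_nat (n := n1.+1)) //= in tot; last 2 first.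
- by rewrite ltnW.
- exact: leq_ltn_trans n2K.
rewrite (big_cat_nat (n := n2.+1) (m := n1.+1)) //= in tot.
have NR : (0 : R) < N%:R by rewrite ltr0n.
have mR : (0 : R) < m0%:R by rewrite ltr0n.
(* There are n2 - n1 terms, each at least m0/N, giving 1/(q+1) - m0/N; the condition Y <= y makes
   m0/N at most 1/(16 (q+1)). *)
have gd : 4 * tau <= \sum_(n1.+1 <= n < n2.+1) (n%:R : R)^-1.
  apply: le_trans (_ : \sum_(n1.+1 <= n < n2.+1) (m0%:R / N%:R : R) <= _); last first.
    rewrite ler_sum_nat // => n /andP[nn1 nn2].
    have n0 : (0 < n)%N by apply: leq_trans nn1.
    rewrite ler_pdivrMr // mulrC ler_pdivlMr ?ltr0n // -natrM ler_nat.
    by rewrite mulnC -leq_divRL.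
  rewrite sumr_const_nat subSS -[X in _ <= X]mulr_natl natrB //.
  rewrite mulrA ler_pdivlMr //.
  have e1 : N%:R <= n2%:R * m0%:R + m0%:R :> R.
    by rewrite -natrM -natrD ler_nat addnC -mulSn ltnW // ltn_ceil.
  have e2 : n1%:R * m0%:R * q.+1%:R <= N%:R * q%:R :> R.
    by rewrite -!natrM ler_nat -mulnA leq_divM.
  have e3 : m0%:R * (16 * q.+1%:R) <= N%:R :> R.
    rewrite -!natrM ler_nat; apply: leq_trans h2; rewrite leq_mul2l; apply/orP; right.
    by rewrite (_ : 16 = 2 * 8)%N // -mulnA leq_mul2l Yy.
  pose Q1 : R := q.+1%:R; have Q0 : 0 < Q1 by rewrite ltr0n.
  have -> : 4 * tau * N%:R = N%:R / (2 * Q1) by rewrite /tau -/Q1; field; rewrite gt_eqF.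
  rewrite ler_pdivrMr ?mulr_gt0 //.
  have e4 : N%:R * Q1 <= (n2%:R * m0%:R + m0%:R) * Q1 by rewrite ler_pM2r.
  have Q : (q%:R : R) = Q1 - 1 by rewrite /Q1 -natr1 addrK.
  rewrite Q -/Q1 in e2; rewrite -/Q1 in e3.
  clear -e2 e3 e4 NR; lra.
have yt : (y%:R : R)^-1 <= tau.
  by rewrite lef_pV2 ?posrE ?mulr_gt0 ?ltr0n // -natrM ler_nat.
have Kyi : (0 : R) < (K * y)%:R^-1 by rewrite invr_gt0 ltr0n.
rewrite lnnM // in tot.
set A := \sum_(y <= n < n1.+1) n%:R^-1 in s1 tot *.
set B := \sum_(n1.+1 <= n < n2.+1) n%:R^-1 in s2 tot gd *.
set C := \sum_(n2.+1 <= n < K * y) n%:R^-1 in s3 tot *.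
have fin : A + B / 2 + C <= L K - tau by set u := (K * y)%:R^-1 in tot Kyi; lra.
have : beta * N%:R * (A + B / 2 + C) <= beta * N%:R * (L K - tau).
  by rewrite ler_wpM2l // mulr_ge0 // ltW.
lra.
Qed.

End Contraction.

(** * The prime number theorem *)

Section PNT.
Variable R : realType.
Local Notation L n := (ln (n%:R : R)).
Local Notation psi := (chebyshev_psi R).
Local Notation E := (psi_err R).

Definition psi_err_eventually (beta : R) :=
  exists N0, forall n, (N0 <= n)%N -> `|E n| <= beta * n%:R.

Lemma lnnX n j : (0 < n)%N -> L (n ^ j)%N = j%:R * L n.
Proof. by move=> n0; rewrite natrX lnXn ?ltr0n // mulr_natl. Qed.

(* Here [k], [r], [l] and [x] stand for [ln K], [ln M], [ln N] and [J ln K], where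
   the windows [K^j, K^(j+1)) with [j < J] cover [1, N / M]. *)
Lemma contraction_bound (e N beta th k r x l C1 A B D : R) :
  0 < N -> 0 < beta -> 0 < k -> 0 <= r -> 0 <= C1 -> 0 < th <= 1 / 4 ->
  1 <= l -> 0 <= x <= l ->
  D = 2 * C1 + beta * k + 20 * (k + r + 2) + 4000 -> 2 * D <= beta * th * l ->
  A <= C1 * N + beta * N * ((1 - 2 * th) * (x * (x + k)) / 2) ->
  B <= l * (10 * N * (k + r + 2)) ->
  e * (l * l) <= 2 * (A + B) + 4000 * N * (1 + l) ->
  e <= (1 - th) * beta * N.
Proof.
move=> N0 b0 k0 r0 C0 /andP[t0 t1] l1 /andP[x0 xl] eD hD hA hB he.
have l0 : 0 < l by clear -l1; lra.
have ll : 0 < l * l by exact: mulr_gt0.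
have e2 : x * (x + k) <= l * (l + k).
  by apply: ler_pM; rewrite ?addr_ge0 ?(ltW k0) ?lerD2r.
have e3 : (1 - 2 * th) * (x * (x + k)) <= l * (l + k) - 2 * th * (l * l).
  have : (1 - 2 * th) * (x * (x + k)) <= (1 - 2 * th) * (l * (l + k)).
    by apply: ler_wpM2l e2; clear -t1; lra.
  have : 0 <= 2 * th * (l * k) by rewrite !mulr_ge0 ?ltW.
  clear; lra.
have e4 : C1 <= C1 * l by rewrite ler_peMr.
rewrite -(ler_pM2r ll); apply: le_trans he _.
have e5 : beta * N * ((1 - 2 * th) * (x * (x + k))) <= beta * N * (l * (l + k) - 2 * th * (l * l)).
  by apply: ler_wpM2l e3; rewrite mulr_ge0 ?ltW.
have e6 : N * (2 * D * l) <= N * (beta * th * l * l).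
  by rewrite ler_pM2l // ler_pM2r.
have e7 : N * C1 <= N * (C1 * l) by rewrite ler_pM2l.
have e8 : N <= N * l by rewrite ler_peMr // ltW.
have e9 : 0 <= N * (l * (k + r + 2)).
  by rewrite !mulr_ge0 ?addr_ge0 ?(ltW N0) ?(ltW l0) ?(ltW k0).
have e10 : 0 <= N * (beta * k * l) by rewrite !mulr_ge0 ?ltW.
have e11 : 0 <= N * (C1 * l) by rewrite !mulr_ge0 // ltW.
rewrite eD in e6.
clear -hA hB e5 e6 e7 e8 e9 e10 e11; lra.
Qed.

(** Every window [K^j, K^(j+1)) beyond a fixed point has the same relative saving, which survives in
    the logarithmic average. It is essential that [th] depends on alpha alone, so that the
    contraction can be iterated until beta falls below alpha. *)
Lemma psi_err_contraction (alpha : R) : 0 < alpha -> exists2 th, 0 < th < 1 &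
  forall beta, alpha <= beta -> psi_err_eventually beta ->
    psi_err_eventually ((1 - th) * beta).
Proof.
move=> a0; have [K [Y [M [tau0 [K1 M0 tau00 W0]]]]] := psi_err_window a0.
have K0 : (0 < K)%N by apply: ltnW.
have LK : 0 < L K by rewrite ln_gt0 // ltr1n.
(* The minimum keeps [th] at most 1/4, hence 1 - 2 th positive. *)
pose tau := Num.min tau0 (L K / 2).
have t0 : 0 < tau by rewrite lt_min tau00 divr_gt0 ?ltr0n.
have tK : tau <= L K / 2 by rewrite ge_min lexx orbT.
pose th := tau / (2 * L K).
have th0 : 0 < th by rewrite divr_gt0 // mulr_gt0 ?ltr0n.
have thE : L K - tau = L K * (1 - 2 * th) by rewrite /th; field; rewrite gt_eqF.
have th1 : th <= 1 / 4 by rewrite ler_pdivrMr ?mulr_gt0 ?ltr0n //; lra.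
clearbody th; exists th; first by rewrite th0; lra.
move=> beta ab [N0 hb].
have b0 : 0 < beta by apply: lt_le_trans ab.
pose M1 := maxn N0 M.
have M10 : (0 < M1)%N by rewrite leq_max M0 orbT.
have W N y : (Y <= y)%N -> (M1 * (K * y) <= N)%N ->
    \sum_(y <= n < K * y) `|E (N %/ n)%N| <= beta * N%:R * (L K - tau).
  move=> h1 h2; apply: le_trans (W0 _ _ ab hb _ _ h1 h2) _.
  by rewrite ler_wpM2l ?mulr_ge0 ?(ltW b0) // lerD2l lerN2 ge_min lexx.
(* Pays for n < K^Y, where no saving is available: fewer than K^Y terms, each at most ln(K^Y) * 10
   N. *)
pose C1 : R := (K ^ Y)%:R * (L (K ^ Y)%N * 10).
have C10 : 0 <= C1 by rewrite !mulr_ge0 ?lnn_ge0.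
have En N n : `|E (N %/ n)%N| <= 10 * N%:R.
  by apply: le_trans (normr_psi_err _ _) _; rewrite ler_pM2l ?ltr0n // ler_nat leq_div.
(* On [K^j, K^(j+1)) the weight ln n is at most (j+1) ln K; summing j + 1 over j < J gives J (J+1) /
   2. *)
have claim J N : (M1 * K ^ J <= N)%N ->
    \sum_(1 <= n < K ^ J) L n * `|E (N %/ n)%N| <=
      C1 * N%:R + beta * N%:R * (L K * (L K - tau)) * (J%:R * (J%:R + 1) / 2).
  elim: J => [|J IH] hN.
    by rewrite expn0 big_geq // mul0r mul0r mulr0 addr0 mulr_ge0.
  have q0 : 0 <= beta * N%:R * (L K * (L K - tau)).
    by rewrite !mulr_ge0 ?(ltW b0) ?(ltW LK) //; lra.
  case: (leqP J.+1 Y) => [JY|YJ].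
    rewrite -[X in X <= _]addr0 lerD //; last first.
      by rewrite mulr_ge0 // divr_ge0 // mulr_ge0 // addr_ge0.
    apply: le_trans (_ : \sum_(1 <= n < K ^ J.+1) L (K ^ Y)%N * 10 * N%:R <= _).
      rewrite ler_sum_nat // => n /andP[n0 nK]; rewrite -mulrA.
      rewrite ler_pM ?lnn_ge0 // lnn_le // ltnW // (leq_trans nK) //.
      by rewrite leq_exp2l.
    rewrite sumr_const_nat -[X in X <= _]mulr_natl /C1 mulrA ler_wpM2r //.
    rewrite ler_wpM2r ?mulr_ge0 ?lnn_ge0 // ler_nat.
    by apply: leq_trans (leq_subr _ _) _; rewrite leq_exp2l.
  have hJ : (K ^ J <= K ^ J.+1)%N by rewrite leq_exp2l.
  have {}IH := IH (leq_trans (leq_mul (leqnn M1) hJ) hN).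
  rewrite (big_cat_nat (n := K ^ J)) ?expn_gt0 ?K0 //=.
  have YK : (Y <= K ^ J)%N by apply: leq_trans (ltnW (ltn_expl J K1)); rewrite -ltnS.
  have w := @W N (K ^ J)%N YK; rewrite -expnS in w; have {}w := w hN.
  have w2 : \sum_(K ^ J <= n < K ^ J.+1) L n * `|E (N %/ n)%N| <=
      (J.+1%:R * L K) * (beta * N%:R * (L K - tau)).
    apply: le_trans (_ : \sum_(K ^ J <= n < K ^ J.+1) (J.+1%:R * L K) * `|E (N %/ n)%N| <= _).
      rewrite ler_sum_nat // => n /andP[n0 nK]; rewrite ler_wpM2r // -lnnX // lnn_le //.
        by apply: leq_trans n0; rewrite expn_gt0 K0.
      exact: ltnW.
    by rewrite -mulr_sumr ler_wpM2l // mulr_ge0 // ltW.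
  rewrite -natr1 in w2 *; set j : R := J%:R in IH w2 *; clear -IH w2; lra.
pose D : R := 2 * C1 + beta * L K + 20 * (L K + L M1 + 2) + 4000.
have D0 : 0 < D.
  have := lnn_ge0 R M1; have : 0 < beta * L K by rewrite mulr_gt0.
  rewrite /D; clear -C10 LK; lra.
(* Large enough for one of the two savings th beta (ln N)^2 to absorb everything linear in ln N. *)
have [X X0 hX] := lnn_unbounded (2 * D / (beta * th) + 1).
exists (maxn X M1) => N; rewrite geq_max => /andP[XN MN].
have N00 : (0 < N)%N by apply: leq_trans MN.
have NM0 : (0 < N %/ M1)%N by rewrite divn_gt0.
have [/andP[J1 J2]] := trunc_log_bounds K1 NM0; set J := trunc_log K _ in J1 J2 *.
have hJ : (M1 * K ^ J <= N)%N by rewrite mulnC -leq_divRL.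
have := claim J N hJ; set x : R := J%:R * L K.
set l := L N; have lX := hX _ XN; rewrite -/l in lX.
have q0 : 0 < 2 * D / (beta * th) by apply: divr_gt0; [apply: mulr_gt0; rewrite ?ltr0n | exact: mulr_gt0].
have l0 : 1 <= l by clear -lX q0; lra.
have xl : x <= l.
  rewrite /x -lnnX // lnn_le ?expn_gt0 ?K0 //; apply: leq_trans hJ; exact: leq_pmull.
have lx : l <= x + L K + L M1.
  have h : (N <= K ^ J.+1 * M1)%N by rewrite ltnW // -ltn_divLR.
  apply: le_trans (lnn_le R N00 h) _; rewrite lnnM ?expn_gt0 ?K0 // lnnX //.
  by rewrite -natr1 /x; clear; lra.
have x0 : 0 <= x by rewrite mulr_ge0 // ltW.
have KN : (K ^ J <= N.+1)%N by rewrite leqW // (leq_trans _ hJ) // leq_pmull.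
have K0' : (0 < K ^ J)%N by rewrite expn_gt0 K0.
have tail : \sum_(K ^ J <= n < N.+1) L n * `|E (N %/ n)%N| <= l * (10 * N%:R * (L K + L M1 + 2)).
  apply: le_trans (_ : \sum_(K ^ J <= n < N.+1) l * `|E (N %/ n)%N| <= _).
    rewrite ler_sum_nat // => n /andP[n0 nN]; rewrite ler_wpM2r // lnn_le //.
    by apply: leq_trans n0.
  rewrite -mulr_sumr ler_wpM2l ?(le_trans ler01) //.
  have s := @sum_window_le R 10 N (K ^ J) N.+1 (ler0n _ _).
  rewrite K0' KN in s; apply: le_trans (s isT _) _.
    by move=> n _; exact: normr_psi_err.
  rewrite ler_wpM2l ?mulr_ge0 //.
  have t := @sum_window_invr R (K ^ J) N.+1; rewrite K0' KN in t; apply: le_trans (t isT) _.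
  have t1 : ((K ^ J)%:R : R)^-1 <= 1 by rewrite invf_le1 ?ler1n ?ltr0n.
  have t2 : (0 : R) <= N.+1%:R^-1 by rewrite invr_ge0.
  have t3 : L N.+1 <= l + 1.
    have /andP[_ h] := lnn_step R N00; have h2 : (N%:R : R)^-1 <= 1 by rewrite invf_le1 ?ler1n ?ltr0n.
    by rewrite /l; set u := _^-1 in h h2; clear -h h2; lra.
  have t4 : L (K ^ J)%N = x by rewrite lnnX.
  rewrite t4; set u := _^-1 in t1 *; set v := _^-1 in t2 *; clear -t1 t2 t3 lx; lra.
have avg := psi_err_average R N00.
rewrite -/l (big_cat_nat (n := K ^ J) (p := N.+1)) //= in avg.
set A := \sum_(1 <= n < K ^ J) _ in avg *; set B := \sum_(K ^ J <= n < _) _ in avg tail *.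
rewrite thE => hA.
have NR : (0 : R) < N%:R by rewrite ltr0n.
have e1 : L K * (L K * (1 - 2 * th)) * (J%:R * (J%:R + 1) / 2) =
   (1 - 2 * th) * (x * (x + L K)) / 2 by rewrite /x; clear; field.
rewrite -[X in _ + X]mulrA e1 in hA.
have e4 : 2 * D <= beta * th * l.
  have : 2 * D / (beta * th) <= l by clear -lX; lra.
  by rewrite ler_pdivrMr ?mulr_gt0 // [l * _]mulrC.
apply: (contraction_bound NR b0 LK (lnn_ge0 R M1) C10 _ l0 _ (erefl _) e4 hA tail avg).
  by rewrite th0.
by rewrite x0.
Qed.

(** Start from Chebyshev's 10 and contract by the fixed factor 1 - th while the bound is at least
    alpha; [bern] shows that finitely many rounds are enough. *)
Theorem psi_err_small (alpha : R) : 0 < alpha -> psi_err_eventually alpha.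
Proof.
move=> a0; have [th /andP[t0 t1] H] := psi_err_contraction a0.
have iter i : psi_err_eventually alpha \/ psi_err_eventually ((1 - th) ^+ i * 10).
  elim: i => [|i [|IH]]; [right| by left |].
    by exists 0%N => n _; rewrite expr0 mul1r normr_psi_err.
  case: (lerP alpha ((1 - th) ^+ i * 10)) => h.
    by right; rewrite exprS -mulrA; exact: H.
  left; case: IH => N0 hN0; exists N0 => n hn; apply: le_trans (hN0 n hn) _.
  by rewrite ler_wpM2r // ltW.
have bern i : (1 - th) ^+ i * (1 + i%:R * th) <= 1.
  elim: i => [|i IH]; first by rewrite mul0r addr0 mulr1.
  apply: le_trans IH; rewrite exprS mulrAC mulrC ler_wpM2l ?exprn_ge0 //; first by lra.
  rewrite -natr1; have : 0 <= (i%:R + 1) * (th * th) by rewrite !mulr_ge0 ?addr_ge0 // ltW.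
  lra.
pose i := (Num.trunc (10 / (alpha * th))).+1.
have hi : 10 / (alpha * th) <= i%:R by exact/ltW/truncnS_gt.
case: (iter i) => // -[N0 hN0]; exists N0 => n hn; apply: le_trans (hN0 n hn) _.
rewrite ler_wpM2r //.
have p0 : 0 <= (1 - th) ^+ i by rewrite exprn_ge0; lra.
move: hi; rewrite ler_pdivrMr ?mulr_gt0 // => hi.
have := bern i => b.
have : (1 - th) ^+ i * 10 <= (1 - th) ^+ i * (i%:R * (alpha * th)) by rewrite ler_wpM2l.
have : alpha * ((1 - th) ^+ i * (1 + i%:R * th)) <= alpha * 1 by rewrite ler_pM2l.
have : 0 <= alpha * (1 - th) ^+ i by rewrite mulr_ge0 // ltW.
lra.
Qed.

End PNT.

(** * Prime powers in short intervals *)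

Section PrimePowers.
Variable R : realType.
Local Notation Lam := (mangoldt R).
Local Notation L n := (ln (n%:R : R)).
Local Notation psi := (chebyshev_psi R).
Local Notation E := (psi_err R).

(** Fewer than (k + 1)(log_2 x + 2) powers have base at most k, and each has Lambda at most ln x, so
    they contribute O(k (ln x)^2), hence O(k sqrt x). *)
Lemma sum_small_prime_powers k x y : (y <= x)%N -> (0 < x)%N ->
  (forall n, (y < n <= x)%N -> Lam n != 0 ->
     exists p i, [/\ prime p, (p <= k)%N & n = (p ^ i)%N]) ->
  \sum_(y.+1 <= n < x.+1) Lam n <= 32 * k.+1%:R * Num.sqrt x%:R.
Proof.
move=> yx x0 H; pose T := trunc_log 2 x.
have Lx := lnn_ge0 R x.
apply: le_trans (_ : \sum_(y.+1 <= n < x.+1)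
   \sum_(p < k.+1) \sum_(i < T.+1) (p ^ i == n)%N%:R * L x <= _).
  rewrite ler_sum_nat // => n /andP[yn nx].
  have S0 (p : 'I_k.+1) : 0 <= \sum_(i < T.+1) (p ^ i == n)%N%:R * L x :> R.
    by apply: sumr_ge0 => i _; rewrite mulr_ge0.
  case: (eqVneq (Lam n) 0) => [->|l0]; first by apply: sumr_ge0 => p _; exact: S0.
  have [|p [i [pp pk e]]] := H n _ l0; first by rewrite yn.
  have iT : (i < T.+1)%N.
    rewrite ltnS trunc_log_max //; apply: leq_trans (_ : n <= _)%N => //.
    by rewrite e; case: i {e} => // i; rewrite leq_exp2r // prime_gt1.
  rewrite (bigD1 (Ordinal (pk : (p < k.+1)%N))) //= (bigD1 (Ordinal iT)) //= -e eqxx mul1r.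
  rewrite -!addrA -[X in X <= _]addr0 lerD //.
    apply: le_trans (mangoldt_le _ _) _; first by apply: leq_ltn_trans yn.
    by rewrite lnn_le //; apply: leq_ltn_trans yn.
  rewrite addr_ge0 // sumr_ge0 // => j _; first by rewrite mulr_ge0.
rewrite exchange_big /=.
apply: le_trans (_ : \sum_(p < k.+1) \sum_(i < T.+1) L x <= _).
  apply: ler_sum => p _; rewrite exchange_big /=; apply: ler_sum => i _.
  rewrite -mulr_suml -[X in _ <= X]mul1r ler_wpM2r // -natr_sum (ler_nat R _ 1).
  rewrite -big_mkcond /= sum1_count.
  rewrite (eq_count (a2 := pred1 (p ^ i)%N)) => [|n]; last by rewrite /= eq_sym.
  by rewrite count_uniq_mem ?iota_uniq // leq_b1.
rewrite !sumr_const !card_ord.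
have -> : L x *+ T.+1 *+ k.+1 = k.+1%:R * (T.+1%:R * L x) by rewrite !mulr_natl.
have TL : T%:R <= 2 * L x.
  have h : (2 ^ T <= x)%N by apply: trunc_logP.
  have := lnn_le R (_ : (0 < 2 ^ T)%N) h; rewrite expn_gt0 => /(_ isT).
  rewrite lnnX //; have := @ln_ge_1subV R 2 (ltr0n _ 2) => h2 h3.
  have : T%:R * (1 - 2^-1) <= T%:R * L 2 by rewrite ler_wpM2l.
  by clear -h3; lra.
have x1 : (1 : R) <= x%:R by rewrite ler1n.
have h := oneD_ln_le x1; set s := Num.sqrt (Num.sqrt _) in h.
have -> : Num.sqrt (x%:R) = s * s :> R by rewrite -expr2 sqr_sqrtr ?sqrtr_ge0.
have -> : 32 * k.+1%:R * (s * s) = k.+1%:R * (32 * (s * s)) by ring.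
rewrite ler_wpM2l // -natr1.
apply: le_trans (_ : 2 * ((1 + L x) * (1 + L x)) <= _).
  have : T%:R * L x <= 2 * L x * L x by rewrite ler_wpM2r.
  by clear -Lx; lra.
have : (1 + L x) * (1 + L x) <= (4 * s) * (4 * s).
  by apply: ler_pM => //; rewrite addr_ge0.
by clear; lra.
Qed.

(** For y near (1 - eps) x, psi(x) - psi(y) is at least eps x / 2, more than the powers of primes p
    <= k can supply. The condition k < p will make k coprime to the field order. *)
Lemma prime_power_dense (k : nat) (eps : R) : 0 < eps < 1 ->
  exists X, forall x, (X <= x)%N -> exists p i,
    [/\ prime p, (k < p)%N, (0 < i)%N, (p ^ i <= x)%N
      & (1 - eps) * x%:R <= (p ^ i)%:R].
Proof.
move=> /andP[e0 e1]; have a0 : 0 < eps / 8 by rewrite divr_gt0 ?ltr0n.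
have [N0 hN0] := psi_err_small a0.
pose X1 : R := N0.+1%:R / (1 - eps); pose X2 : R := (64 * k.+1%:R / eps) ^+ 2.
have e1' : 0 < 1 - eps by rewrite subr_gt0.
exists (maxn N0.+1 (maxn (Num.trunc X1).+1 (Num.trunc X2).+1)) => x.
rewrite !geq_max => /and3P[xN0 x1 x2].
have {}x1 : X1 < x%:R by apply: lt_le_trans (truncnS_gt _) _; rewrite ler_nat.
have {}x2 : X2 < x%:R by apply: lt_le_trans (truncnS_gt _) _; rewrite ler_nat.
have x0 : (0 < x)%N by apply: leq_trans xN0.
have xR : (0 : R) < x%:R by rewrite ltr0n.
apply: contrapT => H.
pose y := Num.trunc ((1 - eps) * x%:R).
have p0 : 0 <= (1 - eps) * x%:R by rewrite mulr_ge0 // ltW.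
have y1 : y%:R <= (1 - eps) * x%:R by rewrite truncn_le.
have y2 : (1 - eps) * x%:R < y.+1%:R by exact: truncnS_gt.
have yx : (y <= x)%N.
  rewrite -(ler_nat R); apply: le_trans y1 _; rewrite ler_piMl // ?ltW //.
  by clear -e0; lra.
have yN0 : (N0 <= y)%N.
  rewrite -ltnS -(ltr_nat R); apply: lt_trans y2.
  have h : (N0%:R : R) < N0.+1%:R by rewrite ltr_nat.
  apply: lt_le_trans h _; move: x1; rewrite /X1 ltr_pdivrMr // mulrC => ?; exact: ltW.
have S := @sum_small_prime_powers k x y yx x0.
have {}S : \sum_(y.+1 <= n < x.+1) Lam n <= 32 * k.+1%:R * Num.sqrt x%:R.
  apply: S => n /andP[yn nx] /mangoldt_neq0[p [i [pp i0 e]]].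
  exists p, i; split => //; rewrite leqNgt; apply/negP => kp; apply: H.
  exists p, i; split => //; rewrite -e // ltW // (lt_le_trans y2) // ler_nat //.
have d : psi x - psi y = \sum_(y.+1 <= n < x.+1) Lam n.
  by rewrite /chebyshev_psi (big_cat_nat (n := y.+1)) //= addrAC subrr add0r.
have Ex := hN0 x (ltnW xN0); have Ey := hN0 y yN0.
have yxR : (y%:R : R) <= x%:R by rewrite ler_nat.
have ay : eps / 8 * y%:R <= eps / 8 * x%:R by rewrite ler_pM2l.
rewrite -d in S.
have lo : eps / 2 * x%:R <= psi x - psi y.
  move: Ex Ey; rewrite /psi_err !ler_norml => /andP[? ?] /andP[? ?].
  have : 0 < eps * x%:R by rewrite mulr_gt0.
  by clear S hN0 H x1 x2 d; lra.
set s := Num.sqrt x%:R in S.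
have s0 : 0 < s by rewrite sqrtr_gt0.
have ss : x%:R = s * s :> R by rewrite -expr2 sqr_sqrtr // ltW.
have h : s <= 64 * k.+1%:R / eps.
  rewrite ler_pdivlMr // -(ler_pM2r s0).
  have := le_trans lo S; rewrite ss; set K := k.+1%:R; clear; lra.
move: x2; rewrite ltNge => /negP; apply; rewrite ss /X2 expr2.
by apply: ler_pM => //; rewrite ltW.
Qed.

End PrimePowers.

(** * Red-blue graphs *)

Section Hall.
Import boot.fintype boot.finset.
Local Open Scope nat_scope.
Variables (I T : finType) (t0 : T).

Lemma card_bigcup_setD (N : I -> {set T}) (D : {set T}) (Y : {set I}) :
  #|\bigcup_(i in Y) (N i :\: D)| = #|(\bigcup_(i in Y) N i) :\: D|.
Proof.
apply: eq_card => x; rewrite inE; apply/bigcupP/andP.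
  by move=> [i iY]; rewrite inE => /andP[xD xi]; split=> //; apply/bigcupP; exists i.
by move=> [xD /bigcupP[i iY xi]]; exists i => //; rewrite inE xD.
Qed.

(** Halmos-Vaughan induction. If a nonempty proper X is tight, match X inside its neighbourhood and
    the rest outside it; otherwise there is slack to match any a with any t in N a. *)
Lemma hall (A : {set I}) (N : I -> {set T}) :
  (forall X : {set I}, X \subset A -> #|X| <= #|\bigcup_(i in X) N i|) ->
  exists2 f : I -> T, {in A &, injective f} & {in A, forall i, f i \in N i}.
Proof.
move: {2}#|A|.+1 (ltnSn #|A|) => n; elim: n A N => // n IH A N; rewrite ltnS => An H.
have [->|[a aA]] := set_0Vmem A.
  by exists (fun=> t0) => [i j|i]; rewrite inE.
case: (boolP [exists X : {set I}, [&& X \proper A, X != set0 &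
    #|\bigcup_(i in X) N i| == #|X|]]).
  case/existsP => X /and3P[XA X0 /eqP tight].
  have XsA := proper_sub XA.
  have [|Y YX|f1 i1 m1] := IH X N.
  - by apply: leq_trans An; exact: proper_card.
  - by apply: H; exact: subset_trans XsA.
  pose D := \bigcup_(i in X) N i.
  have [|Y YA|f2 i2 m2] := IH (A :\: X) (fun i => N i :\: D).
  - apply: leq_trans An; rewrite cardsD (setIidPr XsA).
    by rewrite ltn_subrL card_gt0 X0 (leq_trans _ (subset_leq_card XsA)) // card_gt0.
  - rewrite card_bigcup_setD.
    have YXd : [disjoint X & Y].
      rewrite disjoint_sym; apply/setDidPl; apply/setP => i; rewrite inE.
      case iY: (i \in Y); rewrite ?andbF // andbT.
      by have := subsetP YA i iY; rewrite inE => /andP[].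
    have := H (X :|: Y); rewrite subUset XsA (subset_trans YA (subsetDl _ _)) => /(_ isT).
    rewrite cardsU disjoint_setI0 // cards0 subn0 bigcup_setU -/D cardsU.
    have h : #|(\bigcup_(i in Y) N i) :\: D| = #|\bigcup_(i in Y) N i| - #|D :&: \bigcup_(i in Y) N i|.
      by rewrite cardsD setIC.
    have := subset_leq_card (subsetIr D (\bigcup_(i in Y) N i)).
    by rewrite -/D in tight; rewrite h tight; lia.
  exists (fun i => if i \in X then f1 i else f2 i).
    move=> i j iA jA; case: ifPn => iX; case: ifPn => jX.
    - exact: i1.
    - move=> e; have := m2 j; rewrite inE jX jA => /(_ isT); rewrite inE -e.
      by case/andP=> /negP h _; case: h; apply/bigcupP; exists i => //; exact: m1.
    - move=> e; have := m2 i; rewrite inE iX iA => /(_ isT); rewrite inE e.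
      by case/andP=> /negP h _; case: h; apply/bigcupP; exists j => //; exact: m1.
    - by apply: i2; rewrite inE ?iX ?jX.
  move=> i iA; case: ifPn => iX; first exact: m1.
  by have := m2 i; rewrite !inE iX iA => /(_ isT) /andP[].
move/existsPn => slack.
have [t tN] : exists t, t \in N a.
  have := H [set a]; rewrite sub1set aA cards1 big_set1 => /(_ isT).
  by rewrite card_gt0 => /set0Pn.
have [|Y YA|f i1 m1] := IH (A :\ a) (fun i => N i :\: [set t]).
- by apply: leq_trans An; rewrite (cardsD1 a A) aA.
- rewrite card_bigcup_setD.
  have [->|Y0] := eqVneq Y set0; first by rewrite cards0.
  have YpA : Y \proper A.
    by apply: sub_proper_trans YA _; rewrite properD1.
  have := slack Y; rewrite YpA Y0 /= => ne.
  have := H Y (proper_sub YpA); rewrite leq_eqVlt eq_sym (negbTE ne) /= => lt.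
  have := cardsD1 t (\bigcup_(i in Y) N i); lia.
exists (fun i => if i == a then t else f i).
  move=> i j iA jA; case: eqVneq => [->|ia]; case: eqVneq => [->|ja] //.
  - by move=> e; have := m1 j; rewrite !inE ja jA -e eqxx => /(_ isT).
  - by move=> e; have := m1 i; rewrite !inE ia iA e eqxx => /(_ isT).
  - by apply: i1; rewrite !inE ?ia ?ja.
move=> i iA; case: eqVneq => [->|ia] //.
by have := m1 i; rewrite !inE ia iA => /(_ isT) /andP[].
Qed.

End Hall.

(** * Matching pairs of vertices with hyperedges *)

Section RedBlue.
Import boot.fintype boot.finset.
Local Open Scope nat_scope.
Variable V : finType.
Implicit Types (H X : {set {set V}}) (e p : {set V}).

Definition pairs e : {set {set V}} := [set p : {set V} | (p \subset e) && (#|p| == 2)].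
Definition shadow X := \bigcup_(e in X) pairs e.

Lemma shadow_red_blue H : exists (X P B : {set {set V}}) (g : {set V} -> {set V}),
  [/\ X \subset H /\ P = shadow X, [disjoint P & B], #|H :\: X| = #|B|,
      uniform 2 (P :|: B) & {in P :|: B &, injective g} /\
      {in P :|: B, forall p, g p \in H /\ p \subset g p}].
Proof.
(* |X| - |shadow X|, shifted by the number of all vertex sets so that the natural subtraction never
   truncates. *)
pose wt X := #|X| + (#|{set V}| - #|shadow X|).
have [X XH Xmax] : exists2 X : {set {set V}}, X \subset H & forall Y : {set {set V}}, Y \subset H -> wt Y <= wt X.
  pose X := [arg max_(X > (set0 : {set {set V}}) | X \subset H) wt X].
  by exists X; rewrite /X; case: arg_maxnP; rewrite ?sub0set.
have smax (Z : {set {set V}}) : #|Z| <= #|{set V}| by exact: max_card.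
(* Hall's condition for Y outside X: adding Y to X does not raise the weight, so Y has at least |Y|
   pairs outside the shadow of X. *)
have [|fb ib mb] := @hall _ _ (set0 : {set V}) (H :\: X) (fun e => pairs e :\: shadow X).
  move=> Y YH; rewrite card_bigcup_setD.
  have YX : [disjoint X & Y].
    rewrite disjoint_sym; apply/setDidPl; apply/setP => i; rewrite inE.
    case iY: (i \in Y); rewrite ?andbF // andbT.
    by have := subsetP YH i iY; rewrite inE => /andP[].
  have := Xmax (X :|: Y); rewrite subUset XH (subset_trans YH (subsetDl _ _)) => /(_ isT).
  rewrite /wt cardsU disjoint_setI0 // cards0 subn0.
  have -> : shadow (X :|: Y) = shadow X :|: shadow Y by rewrite /shadow bigcup_setU.
  rewrite -/(shadow Y) cardsU.
  have := smax (shadow X :|: shadow Y); rewrite cardsU.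
  have := cardsD (shadow Y) (shadow X); rewrite setIC.
  have := subset_leq_card (subsetIr (shadow X) (shadow Y)).
  have := smax (shadow X); move: #|shadow X| #|shadow Y| #|shadow X :&: shadow Y| #|shadow Y :\: shadow X| #|{set V}| #|X| #|Y| => a b c d m x y; lia.
pose nb p : {set {set V}} := [set e in X | p \subset e].
(* Hall's condition for Z in the shadow: deleting from X all hyperedges over Z removes Z from the
   shadow and does not raise the weight, so at least |Z| hyperedges are deleted. *)
have [|gr ir mr] := @hall _ _ (set0 : {set V}) (shadow X) nb.
  move=> Z ZP; set NZ := \bigcup_(i in Z) nb i.
  have NZX : NZ \subset X.
    by apply/bigcupsP => p _; apply/subsetP => e; rewrite inE => /andP[].
  have := Xmax (X :\: NZ); rewrite (subset_trans (subsetDl _ _) XH) => /(_ isT).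
  have sub : shadow (X :\: NZ) \subset shadow X :\: Z.
    apply/subsetP => p /bigcupP[e]; rewrite inE => /andP[eN eX] pe.
    rewrite inE; apply/andP; split; last by apply/bigcupP; exists e.
    apply: contra eN => pZ; apply/bigcupP; exists p => //.
    by rewrite inE eX /=; move: pe; rewrite inE => /andP[].
  have := subset_leq_card sub; rewrite /wt !cardsD (setIidPr NZX) (setIidPr ZP).
  have := subset_leq_card NZX; have := subset_leq_card ZP; have := smax (shadow X); move: #|shadow X| #|shadow (X :\: NZ)| #|NZ| #|Z| #|{set V}| #|X| => a b c d m x; lia.
pose B := fb @: (H :\: X).
have fB p : p \in B -> exists2 e, e \in H :\: X & p = fb e by move=> /imsetP.
pose g p := if p \in shadow X then gr p else odflt set0 [pick e in H :\: X | fb e == p].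
have BP p : p \in B -> p \notin shadow X.
  by move=> /fB[e eH ->]; have := mb e eH; rewrite inE => /andP[].
have gB p : p \in B -> [/\ g p \in H :\: X, fb (g p) = p & p \subset g p].
  move=> pB; rewrite /g (negbTE (BP p pB)); case: pickP => [e /andP[eH /eqP <-]|h].
    by split=> //; have := mb e eH; rewrite !inE => /and3P[].
  by have [e eH pe] := fB p pB; have := h e; rewrite eH pe eqxx.
have gP p : p \in shadow X -> g p \in X /\ p \subset g p.
  by move=> pP; rewrite /g pP; have := mr p pP; rewrite inE => /andP.
exists X, (shadow X), B, g; split => //.
- rewrite disjoint_sym disjoint_subset; apply/subsetP => p pB; exact: BP.
- by rewrite card_in_imset.
- apply/forall_inP => p; rewrite inE => /orP[/bigcupP[e _]|/fB[e eH ->]].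
    by rewrite inE => /andP[].
  by have := mb e eH; rewrite !inE => /and3P[].
split.
  move=> p q; rewrite !inE => /orP[pP|pB] /orP[qP|qB] e.
  - by move: e; rewrite /g pP qP; exact: ir.
  - by have [] := gB q qB; rewrite -e inE; have [-> _] := gP p pP.
  - by have [] := gB p pB; rewrite e inE; have [-> _] := gP q qP.
  - by have [_ <- _] := gB p pB; have [_ <- _] := gB q qB; rewrite e.
move=> p; rewrite inE => /orP[/gP[gX ps]|/gB[gX _ ps]]; split => //.
  exact: (subsetP XH).
by move: gX; rewrite inE => /andP[].
Qed.

Lemma contains_berge_trans (U : finType) (F : {set {set U}}) (G H : {set {set V}})
    (g : {set V} -> {set V}) : {in G &, injective g} ->
  {in G, forall p, g p \in H /\ p \subset g p} ->
  contains_berge F G -> contains_berge F H.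
Proof.
move=> ig hg /contains_bergeP[phi [f [iphi jf h]]]; apply/contains_bergeP.
exists phi, (g \o f); split => // [x y xF yF /= e|e eF /=].
  by apply: jf => //; apply: ig e; [have [] := h x xF | have [] := h y yF].
have [fG pf] := h e eF; have [gH fg] := hg _ fG.
by split=> //; exact: subset_trans fg.
Qed.

End RedBlue.

(** * Graphs without a complete bipartite subgraph *)

Section K2tFree.
Import boot.fintype boot.finset.
Local Open Scope nat_scope.
Variables (V : finType) (t : nat) (G : {set {set V}}).
Hypothesis G2 : uniform 2 G.
Hypothesis Gfree : ~~ contains_berge (complete_bipartite 2 t) G.

Definition nbhd (u : V) : {set V} := [set w | [set u; w] \in G].

Lemma nbhd_neq u w : w \in nbhd u -> u != w.
Proof.
by rewrite inE => /(forall_inP G2); rewrite cards2; case: (u == w).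
Qed.

Lemma nbhd_sym u w : (w \in nbhd u) = (u \in nbhd w).
Proof. by rewrite !inE setUC. Qed.

Lemma codegree_lt u v : u != v -> #|nbhd u :&: nbhd v| < t.
Proof.
move=> uv; rewrite ltnNge; apply: contra Gfree => tle.
pose W := nbhd u :&: nbhd v.
pose c (j : 'I_t) : V := enum_val (widen_ord tle j).
have cW j : c j \in W by exact: enum_valP.
have cinj : injective c.
  by move=> i j /enum_val_inj /(congr1 val) /= ij; apply: val_inj.
pose phi (x : 'I_2 + 'I_t) : V :=
  match x with inl i => if i == ord0 then u else v | inr j => c j end.
have cu j : c j != u.
  by have := cW j; rewrite inE => /andP[/nbhd_neq]; rewrite eq_sym.
have cv j : c j != v.
  by have := cW j; rewrite inE => /andP[_ /nbhd_neq]; rewrite eq_sym.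
have iphi : injective phi.
  case=> [i|i] [j|j] /=.
  - case: (eqVneq i ord0) => [->|i0]; case: (eqVneq j ord0) => [->|j0] // e.
    + by rewrite e eqxx in uv.
    + by rewrite e eqxx in uv.
    + congr inl; apply: val_inj => /=; case: i i0 {e} => [[|[|//]] ?]; case: j j0 => [[|[|//]] ?] //.
  - by case: ifP => _ e; [have := cu j | have := cv j]; rewrite -e eqxx.
  - by case: ifP => _ e; [have := cu i | have := cv i]; rewrite e eqxx.
  - by move=> /cinj ->.
apply/contains_bergeP; exists phi, (fun e : {set 'I_2 + 'I_t} => phi @: e); split=> //.
  by move=> x y _ _; exact: imset_inj.
move=> _ /imset2P[i j _ _ ->]; split=> //; rewrite imsetU1 imset_set1 /=.
have := cW j; rewrite !inE => /andP[h1 h2]; by case: ifP.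
Qed.

Lemma sum_degree : \sum_u #|nbhd u| = 2 * #|G|.
Proof.
transitivity (\sum_u \sum_(e in G) (u \in e)).
  apply: eq_bigr => u _; rewrite -sum1_card -big_mkcondr /=.
  rewrite (partition_big (fun w => [set u; w]) (fun e => (e \in G) && (u \in e))) /=.
    apply: eq_bigr => e /andP[eG ue].
    have := forall_inP G2 e eG => /cards2P[x [y [xy ee]]].
    have [w uw ew] : exists2 w, u != w & e = [set u; w].
      move: ue; rewrite ee !inE => /orP[] /eqP ->; first by exists y.
      by exists x; [rewrite eq_sym | rewrite setUC].
    rewrite (big_pred1 w) // => z; rewrite /= ew inE.
    apply/andP/eqP => [[_ /eqP e1]|->]; last by rewrite -ew eG.
    have : w \in [set u; z] by rewrite e1 !inE eqxx orbT.
    by rewrite !inE eq_sym (negbTE uw) /= => /eqP.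
  by move=> w; rewrite inE => ->; rewrite !inE eqxx.
rewrite exchange_big /= -sum1_card big_distrr /=; apply: eq_bigr => e eG.
rewrite muln1 -(eqP (forall_inP G2 e eG)) -sum1_card [RHS]big_mkcond.
by apply: eq_bigr => u _; case: (u \in e).
Qed.

(** Counts triples (u, v, w) with w adjacent to both u and v: the diagonal u = v gives the degree
    sum, every other pair at most t - 1. *)
Lemma sum_degree_sqr : \sum_u #|nbhd u| ^ 2 <= 2 * #|G| + t.-1 * #|V| ^ 2.
Proof.
apply: (@leq_trans (\sum_w \sum_u \sum_v (w \in nbhd u) * (w \in nbhd v))).

  apply: eq_leq; apply: eq_bigr => w _.
  have -> : #|nbhd w| = \sum_u (w \in nbhd u).
    by rewrite -sum1_card big_mkcond; apply: eq_bigr => u _; rewrite nbhd_sym.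
  by rewrite -mulnn big_distrlr.
rewrite exchange_big /=; under eq_bigr do rewrite exchange_big /=.
have E u v : \sum_i (i \in nbhd u) * (i \in nbhd v) = #|nbhd u :&: nbhd v|.
  rewrite -sum1_card [RHS]big_mkcond; apply: eq_bigr => i _.
  by rewrite in_setI; do 2!case: (_ \in _).
apply: leq_trans (_ : \sum_(u : V) (#|nbhd u| + \sum_(v : V) t.-1) <= _).
  apply: leq_sum => u _; rewrite (bigD1 u) //= [X in _ <= _ + X](bigD1 u) //=.
  rewrite E setIid leq_add2l; apply: leq_trans (leq_addl _ _).
  apply: leq_sum => v vu; rewrite E; have := @codegree_lt u v; rewrite eq_sym vu => /(_ isT).
  by case: t.
rewrite big_split /= sum_degree leq_add2l !sum_nat_const.
by rewrite mulnA mulnn mulnC.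
Qed.

Lemma kovari_sos_turan :
  (2 * #|G|) ^ 2 <= #|V| * (2 * #|G| + t.-1 * #|V| ^ 2).
Proof.
apply: leq_trans (leq_mul (leqnn _) sum_degree_sqr); rewrite -sum_degree.
rewrite -(@leq_pmul2l 2) // -mulnn big_distrlr /= big_distrr /=.
under eq_bigr do rewrite big_distrr /=.
apply: leq_trans (_ : \sum_(u : V) \sum_(v : V) (#|nbhd u| ^ 2 + #|nbhd v| ^ 2) <= _).
  by apply: leq_sum => u _; apply: leq_sum => v _; exact: nat_Cauchy.
under eq_bigr do rewrite big_split /= sum_nat_const.
by rewrite big_split /= sum_nat_const -big_distrr /= addnn -mul2n.
Qed.

(** Double counting of pairs inside cliques. A clique through the edge uv is determined by its other
    r - 2 vertices, which lie among the at most t - 1 common neighbours. *)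
Lemma card_cliques r (P X : {set {set V}}) : 2 <= r -> P \subset G ->
  (forall e : {set V}, e \in X -> #|e| = r /\ pairs e \subset P) ->
  'C(r, 2) * #|X| <= 'C(t.-1, r - 2) * #|P|.
Proof.
move=> r2 PG hX.
have -> : 'C(r, 2) * #|X| = \sum_(p in P) #|[set e in X | p \subset e]|.
  transitivity (\sum_(e in X) #|pairs e|).
    rewrite (eq_bigr (fun=> 'C(r, 2))) ?sum_nat_const 1?mulnC // => e eX.
    by have [er _] := hX e eX; rewrite /pairs cards_draws er.
  transitivity (\sum_(e in X) \sum_(p in P) (p \subset e)).
    apply: eq_bigr => e eX; rewrite -sum1_card -big_mkcondr /=.
    apply: eq_bigl => p; rewrite inE; have [_ /subsetP s] := hX e eX.
    apply/andP/andP => [[pe p2]|[pP pe]]; first by rewrite pe (s p) // inE pe.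
    by rewrite pe (forall_inP G2) // (subsetP PG).
  rewrite exchange_big /=; apply: eq_bigr => p pP.
  by rewrite -sum1_card -big_mkcondr; apply: eq_bigl => e; rewrite inE.
rewrite mulnC -sum_nat_const; apply: leq_sum => p pP.
have /cards2P[u [v [uv ep]]] := forall_inP G2 p (subsetP PG p pP).
pose W := nbhd u :&: nbhd v.
pose sh (e : {set V}) := e :\: p.
rewrite -(@card_in_imset _ _ sh); last first.
  move=> e1 e2; rewrite !inE => /andP[_ p1] /andP[_ p2]; rewrite /sh => e12.
  by rewrite -(setID e1 p) -[RHS](setID e2 p) (setIidPr p1) (setIidPr p2) e12.
apply: leq_trans (_ : #|[set B : {set V} | B \subset W & #|B| == r - 2]| <= _).
  apply: subset_leq_card; apply/subsetP => _ /imsetP[e eXp ->]; have /andP[eX pe] : (e \in X) && (p \subset e) by rewrite inE in eXp.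
  have [er /subsetP pP'] := hX e eX.
  have up : u \in p by rewrite ep !inE eqxx.
  have vp : v \in p by rewrite ep !inE eqxx orbT.
  rewrite inE; apply/andP; split; last first.
    by rewrite cardsD (setIidPr pe) er ep cards2 uv.
  apply/subsetP => w; rewrite !inE => /andP[wp we].
  have wu : u != w by apply: contraNneq wp => <-.
  have wv : v != w by apply: contraNneq wp => <-.
  apply/andP; split; apply: (subsetP PG); apply: pP'.
    by rewrite inE subUset !sub1set (subsetP pe) // we cards2 wu.
  by rewrite inE subUset !sub1set (subsetP pe) // we cards2 wv.
rewrite cards_draws leq_bin2l //; have := codegree_lt uv; by rewrite -/W; case: t.
Qed.

End K2tFree.

Section UpperBound.
Import boot.fintype boot.finset.
Local Open Scope nat_scope.

(** A blue edge accounts for one hyperedge, a red one for at most C(t-1, r-2) / C(r, 2). Which of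
    the two is larger decides between the regimes t <= r and t >= r + 1. *)
Lemma berge_K2t_bound (V : finType) (r t : nat) (H : {set {set V}}) :
  2 <= r -> uniform r H -> ~~ contains_berge (complete_bipartite 2 t) H ->
  exists2 e, (2 * e) ^ 2 <= #|V| * (2 * e + t.-1 * #|V| ^ 2) &
    'C(r, 2) * #|H| <= maxn 'C(r, 2) 'C(t.-1, r - 2) * e.
Proof.
move=> r2 Hr Hfree.
have [X [P [B [g [[XH Psh] PB HB G2 [ig hg]]]]]] := shadow_red_blue H.
have Gfree : ~~ contains_berge (complete_bipartite 2 t) (P :|: B).
  by apply: contra Hfree; exact: (contains_berge_trans ig hg).
exists #|P :|: B|; first exact: kovari_sos_turan.
have h := @card_cliques V t (P :|: B) G2 Gfree r P X r2 (subsetUl _ _).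
have {}h : 'C(r, 2) * #|X| <= 'C(t.-1, r - 2) * #|P|.
  apply: h => e eX; split; first by apply/eqP/(forall_inP Hr)/(subsetP XH).
  by rewrite Psh; apply: bigcup_sup.
rewrite -(cardsID X H) (setIidPr XH) HB mulnDr cardsU disjoint_setI0 // cards0 subn0 mulnDr.
apply: leq_add; last by rewrite leq_mul2r leq_maxl orbT.
by apply: leq_trans h _; rewrite leq_mul2r leq_maxr orbT.
Qed.

End UpperBound.

(** * Füredi's graph *)

Section RootsOfUnity.
Import boot.fintype boot.finset.

Lemma card_unity_roots (F : finFieldType) (k : nat) :
  (k %| #|F|.-1)%N -> #|[set x : F | x ^+ k == 1]| = k.
Proof.
move=> kq; have q1 := card_finNzRing_gt1 F.
have q0 : (0 < #|F|.-1)%N by rewrite -subn1 subn_gt0.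
have k0 : (0 < k)%N by apply: dvdn_gt0 kq.
have : has (#|F|.-1).-primitive_root (enum [set~ (0 : F)]).
  apply: has_prim_root => //; last 2 first.
  - exact: enum_uniq.
  - by rewrite -cardE cardsC1.
  apply/allP => x; rewrite mem_enum !inE => x0; rewrite unity_rootE.
  by apply/eqP/(mulfI x0); rewrite mulr1 -exprS prednK ?expf_card // ltnW.
case/hasP => z _ pz; have := dvdn_prim_root pz kq; set w := z ^+ _ => pw.
transitivity #|[set w ^+ i | i : 'I_k]|; last first.
  rewrite card_imset ?card_ord // => i j /eqP; rewrite (eq_prim_root_expr pw).
  by rewrite !modn_small // => /eqP /val_inj.
apply: eq_card => x; rewrite inE; apply/eqP/imsetP => [xk|[i _ ->]].
  by have [i ->] := prim_rootP pw xk; exists i.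
by rewrite exprAC (prim_expr_order pw) expr1n.
Qed.

End RootsOfUnity.

Section Furedi.
Import boot.fintype boot.finset.
Variables (F : finFieldType) (k : nat).
Hypothesis kq : (k %| #|F|.-1)%N.
Local Notation Q := #|F|.
Local Notation vec := (F * F)%type.
Implicit Types (u v w : vec).

Let k_gt0 : (0 < k)%N.
Proof.
by apply: dvdn_gt0 kq; rewrite -subn1 subn_gt0 card_finNzRing_gt1.
Qed.

Definition mu : {set F} := [set x : F | x ^+ k == 1].
Definition form u v : F := u.1 * v.2 + u.2 * v.1.
Definition det2 u v : F := u.1 * v.2 - u.2 * v.1.
Definition scale (h : F) u : vec := (h * u.1, h * u.2).
Definition mu_class u : {set vec} := [set scale h u | h in mu].
Definition nonzero u := u != (0, 0).

Lemma mu1 : 1 \in mu. Proof. by rewrite inE expr1n. Qed.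

Lemma mu_neq0 x : x \in mu -> x != 0.
Proof.
rewrite inE; apply: contraTneq => ->.
by rewrite expr0n eqn0Ngt k_gt0 /= eq_sym oner_eq0.
Qed.

Lemma muM x y : x \in mu -> y \in mu -> x * y \in mu.
Proof. by rewrite !inE exprMn => /eqP-> /eqP->; rewrite mulr1. Qed.

Lemma muV x : x \in mu -> x^-1 \in mu.
Proof. by rewrite !inE exprVn => /eqP->; rewrite invr1. Qed.

Lemma muMl x y : x \in mu -> (x * y \in mu) = (y \in mu).
Proof.
move=> xm; apply/idP/idP => [h|]; last exact: muM.
by rewrite -[y](mulKf (mu_neq0 xm)) muM // muV.
Qed.

Lemma formC u v : form u v = form v u.
Proof. by rewrite /form; ring. Qed.

Lemma formZr h u v : form u (scale h v) = h * form u v.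
Proof. by rewrite /form /scale /=; ring. Qed.

Lemma form_neq0 u v : form u v \in mu -> nonzero v.
Proof.
move=> /mu_neq0; apply: contraNneq => ->; by rewrite /form /= !mulr0 addr0.
Qed.

Lemma mu_class_refl u : u \in mu_class u.
Proof. by apply/imsetP; exists 1; rewrite ?mu1 // /scale !mul1r; case: u. Qed.

Lemma mu_classP u v : mu_class u = mu_class v -> exists2 h, h \in mu & u = scale h v.
Proof. by move=> e; have := mu_class_refl u; rewrite e => /imsetP. Qed.

Lemma mu_class_scale h u : h \in mu -> mu_class (scale h u) = mu_class u.
Proof.
move=> hm; apply/setP => w; apply/imsetP/imsetP => -[g gm ->].
  by exists (g * h); rewrite ?muM // /scale /= !mulrA.
exists (g * h^-1); first by rewrite muM // muV.
by rewrite /scale /= !mulrA !mulfVK // mu_neq0.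
Qed.

Lemma form_mu_class u v v' : mu_class v = mu_class v' ->
  (form u v \in mu) = (form u v' \in mu).
Proof. by move=> /mu_classP[h hm ->]; rewrite formZr muMl. Qed.

Lemma card_mu_class u : nonzero u -> #|mu_class u| = k.
Proof.
move=> u0; rewrite card_imset ?card_unity_roots // => g h [].
move: u0; rewrite /nonzero; case: u => a b /=; rewrite xpair_eqE negb_and.
by case/orP => n0 e1 e2; [apply: (mulIf n0 e1) | apply: (mulIf n0 e2)].
Qed.

Definition vertices : {set {set vec}} := mu_class @: [set u | nonzero u].

(** Orbits are counted through their vectors: an orbit of a nonzero vector has exactly k
    elements. *)
Lemma card_vertices_in (E : {set {set vec}}) : E \subset vertices ->
  #|[set u | mu_class u \in E]| = (#|E| * k)%N.
Proof.
move=> /subsetP EW; rewrite -sum1_card.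
rewrite (partition_big mu_class (mem E)) => [|u]; last by rewrite inE.
rewrite -sum_nat_const; apply: eq_bigr => P PE.
have /imsetP[u] := EW P PE; rewrite inE => u0 eP.
rewrite sum1_card -(card_mu_class u0); apply: eq_card => w; rewrite [LHS]inE inE.
apply/andP/idP => [[_ /eqP e]|]; first by rewrite -eP -e mu_class_refl.
move=> /imsetP[h hm ->]; by rewrite mu_class_scale // -eP.
Qed.

Lemma card_vertices : (#|vertices| * k = Q ^ 2 - 1)%N.
Proof.
rewrite -card_vertices_in // -mulnn -card_prod subn1 -(cardC1 ((0, 0) : vec)).
apply: eq_card => u; rewrite [LHS]inE [RHS]inE.
apply/imsetP/idP => [[v]|u0]; last by exists u; rewrite ?inE.
rewrite inE => v0 /mu_classP[h hm ->] /=.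
move: v0; rewrite /nonzero; case: v => a b; rewrite !xpair_eqE /= !mulf_eq0.
by rewrite (negbTE (mu_neq0 hm)).
Qed.

(* [w] is recovered from [(form u w, form v w)] by Cramer's rule *)
Lemma card_form2 u v (A B : {set F}) : det2 u v != 0 ->
  #|[set w | (form u w \in A) && (form v w \in B)]| = (#|A| * #|B|)%N.
Proof.
move=> d0; rewrite -cardsX.
pose sol (p : F * F) : vec :=
  ((u.1 * p.2 - v.1 * p.1) / det2 u v, (p.1 * v.2 - p.2 * u.2) / det2 u v).
have s1 p : form u (sol p) = p.1.
  by move: d0; rewrite /form /sol /det2 /= => d0; field.
have s2 p : form v (sol p) = p.2.
  by move: d0; rewrite /form /sol /det2 /= => d0; field.
have s3 w : w = sol (form u w, form v w).
  move: d0; rewrite /form /sol /det2; case: w => a b /= d0; congr (_, _); by field.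
have isol : injective sol.
  by move=> [a b] [c d] e; have := s1 (a, b); have := s2 (a, b); rewrite e s1 s2 /= => -> ->.
rewrite -[RHS](card_imset _ isol).
apply: eq_card => w; rewrite [LHS]inE; apply/andP/imsetP => [[wA wB]|[[a b] /setXP[aA bB] ->]].
  by exists (form u w, form v w); first exact/setXP.
by rewrite s1 s2.
Qed.

Lemma det2_ex u : nonzero u -> exists v, det2 u v != 0.
Proof.
rewrite /nonzero; case: u => a b; rewrite xpair_eqE negb_and.
case/orP => n0; [exists (0, 1) | exists (1, 0)]; rewrite /det2 /=.
  by rewrite mulr1 mulr0 subr0.
by rewrite mulr1 mulr0 sub0r oppr_eq0.
Qed.

Lemma card_form u : nonzero u -> #|[set w | form u w \in mu]| = (k * Q)%N.
Proof.
move=> /det2_ex[v d0]; rewrite -[in RHS](card_unity_roots kq) -cardsT -(card_form2 _ _ d0).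
by apply: eq_card => w; rewrite !inE andbT.
Qed.

(** These are the vectors whose orbit would carry a loop, not those with [form u u] zero. *)
Definition isotropic u := form u u \in mu.

(** Such a u is determined by u.1 and [form u u] in mu: the form is 2 u.1 u.2, and being nonzero it
    forces 2 u.1 to be invertible. *)
Lemma card_isotropic : (#|[set u | isotropic u]| <= Q * k)%N.
Proof.
rewrite -[k in leqRHS](card_unity_roots kq) -/mu -cardsT -cardsX.
rewrite -(@card_in_imset _ _ (fun u => (u.1, form u u))).
  apply: subset_leq_card; apply/subsetP => _ /imsetP[u um ->].
  by apply/setXP; split; [exact: in_setT | rewrite inE in um].
move=> [a b] [c d]; rewrite !inE /isotropic => m1 m2 [] /= e; subst c.
have := mu_neq0 m1; rewrite /form /= => n0 h.
have e2 : (a + a) * b = (a + a) * d.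
  by transitivity (a * b + b * a); [ring | rewrite h; ring].
have a20 : a + a != 0.
  apply: contraNneq n0 => z; have -> : a * b + b * a = (a + a) * b by ring.
  by rewrite z mul0r.
by congr (_, _); exact: (mulfI a20 e2).
Qed.

Definition codegree_vec u v : {set vec} := [set w | (form u w \in mu) && (form v w \in mu)].

Lemma det2_eq0P u v : nonzero u -> det2 u v = 0 -> exists c, v = scale c u.
Proof.
rewrite /nonzero; case: u => a b; case: v => c d; rewrite xpair_eqE negb_and /det2 /=.
case/orP => n0 e.
  exists (c / a); rewrite /scale /= mulfVK //; congr (_, _).
  by apply: (mulfI n0); rewrite (subr0_eq e); field.
exists (d / b); rewrite /scale /= mulfVK //; congr (_, _).
by apply: (mulfI n0); rewrite -(subr0_eq e); field.
Qed.

(** Here w = c u, and [form u w] = c [form u u] determines c. *)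
Lemma card_form_det0 u : nonzero u ->
  (#|[set w | (form u w \in mu) && (det2 u w == 0%R)]| <= k)%N.
Proof.
move=> u0; rewrite -[k](card_unity_roots kq).
rewrite -(@card_in_imset _ _ (form u)).
  apply: subset_leq_card; apply/subsetP => _ /imsetP[w wS ->].
  by move: wS; rewrite inE => /andP[].
move=> w w'; rewrite inE => /andP[wm /eqP d]; rewrite inE => /andP[wm' /eqP d'].
have [c ->] := det2_eq0P u0 d; have [c' ->] := det2_eq0P u0 d'.
rewrite !formZr => e.
have n0 : form u u != 0.
  have := mu_neq0 wm; have [c1 ->] := det2_eq0P u0 d.
  by rewrite formZr mulf_eq0 negb_or => /andP[].
by rewrite (mulIf n0 e).
Qed.

Definition adjacent (P P' : {set vec}) :=
  [exists u in P, exists v in P', form u v \in mu].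

Lemma adjacentE u v : adjacent (mu_class u) (mu_class v) = (form u v \in mu).
Proof.
apply/exists_inP/idP => [[u' /imsetP[g gm ->] /exists_inP[v' /imsetP[h hm ->]]]|h].
  by rewrite formZr formC formZr !muMl // formC.
exists u; first exact: mu_class_refl.
by apply/exists_inP; exists v; first exact: mu_class_refl.
Qed.

Definition furedi_triangles : {set {set {set vec}}} :=
  [set e : {set {set vec}} | [&& #|e| == 3, e \subset vertices &
     [forall P in e, forall P' in e, (P != P') ==> adjacent P P']]].

Lemma furedi_uniform : uniform 3 furedi_triangles.
Proof. by apply/forall_inP => e; rewrite inE => /and3P[]. Qed.

(** The core of a Berge copy would give k + 1 common neighbours, that is k (k+1) vectors, against
    k^2 for independent u, v. If v = c u, a single common neighbour forces c into mu, so u and v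
    have the same orbit. *)
Lemma furedi_free : ~~ contains_berge (complete_bipartite 2 k.+1) furedi_triangles.
Proof.
apply/negP => /contains_bergeP[phi [f [iphi jf h]]].
have key (i : 'I_2) (j : 'I_k.+1) : [/\ phi (inl i) \in vertices, phi (inr j) \in vertices &
    adjacent (phi (inl i)) (phi (inr j))].
  have [|fH sub] := h [set inl i; inr j]; first by apply/imset2P; exists i j.
  move: fH; rewrite inE => /and3P[_ /subsetP sW /forall_inP adj].
  have p1 : phi (inl i) \in f [set inl i; inr j].
    by apply: (subsetP sub); apply: imset_f; rewrite !inE eqxx.
  have p2 : phi (inr j) \in f [set inl i; inr j].
    by apply: (subsetP sub); apply: imset_f; rewrite !inE eqxx orbT.
  split; [exact: sW | exact: sW |].
  have /forall_inP/(_ _ p2)/implyP := adj _ p1; apply.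
  by apply/negP => /eqP /iphi.
have [/imsetP[u u0 eu] _ _] := key ord0 ord0; rewrite inE in u0.
have [/imsetP[v v0 ev] _ _] := key ord_max ord0; rewrite inE in v0.
pose C := [set phi (inr j) | j : 'I_k.+1].
have CW : C \subset vertices.
  by apply/subsetP => _ /imsetP[j _ ->]; have [] := key ord0 j.
have cC : #|C| = k.+1 by rewrite card_imset ?card_ord // => i j /iphi [].
have sub : [set w | mu_class w \in C] \subset codegree_vec u v.
  apply/subsetP => w; rewrite inE => /imsetP[j _ ej].
  have [_ _ a1] := key ord0 j; have [_ _ a2] := key ord_max j.
  by move: a1 a2; rewrite inE eu ev -ej !adjacentE => -> ->.
have := subset_leq_card sub; rewrite card_vertices_in // cC.
have [d|d] := eqVneq (det2 u v) 0; last first.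
  by rewrite card_form2 // card_unity_roots // leq_pmul2r // ltnn.
have [c ec] := det2_eq0P u0 d.
suff -> : codegree_vec u v = set0 by rewrite cards0 leqn0 muln_eq0 (gtn_eqF k_gt0).
apply/setP => w; rewrite in_set0 inE; apply/negP => /andP[wu wv].
have cm : c \in mu.
  move: wv; rewrite ec formC formZr formC mulrC muMl //.
have : phi (inl ord0) = phi (inl ord_max) by rewrite eu ev ec mu_class_scale.
by move=> /iphi.
Qed.

(** Ordered edges at the level of vectors, without the lower-order exceptions: a dependent pair may
    give a single orbit, and an orbit with a loop would count among its own neighbours. *)
Definition good_pairs : {set vec * vec} :=
  [set p | [&& form p.1 p.2 \in mu, det2 p.1 p.2 != 0, ~~ isotropic p.1 & ~~ isotropic p.2]].

(** The k^2 common neighbours fill at least k orbits; as neither u nor v carries a loop, all of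
    these differ from the orbits of u and v. *)
Lemma card_triangles_on u v : (u, v) \in good_pairs ->
  (k <= #|[set e in furedi_triangles | (mu_class u \in e) && (mu_class v \in e)]|)%N.
Proof.
rewrite inE => /= /and4P[uv d iu iv].
have v0 := form_neq0 uv; have u0 : nonzero u by apply: (@form_neq0 v); rewrite formC.
have nuv : mu_class u != mu_class v.
  apply: contraNneq d => /mu_classP[h _ ->]; rewrite /det2 /scale /=; apply/eqP; ring.
have uW : mu_class u \in vertices by apply: imset_f; rewrite inE.
have vW : mu_class v \in vertices by apply: imset_f; rewrite inE.
pose C := mu_class @: codegree_vec u v.
have CW : C \subset vertices.
  apply/subsetP => _ /imsetP[w wS ->]; apply: imset_f; rewrite inE in wS.
  by rewrite inE; case/andP: wS => /form_neq0.
have kC : (k <= #|C|)%N.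
  rewrite -(leq_pmul2r k_gt0) -card_vertices_in //.
  rewrite -{1 2}(card_unity_roots kq) -(card_form2 _ _ d) -/(codegree_vec u v).
  by apply: subset_leq_card; apply/subsetP => w wS; rewrite inE; exact: imset_f.
have uC : mu_class u \notin C.
  apply/imsetP => -[w]; rewrite inE => /andP[wm _] e; case/negP: iu.
  by rewrite /isotropic (form_mu_class u e).
have vC : mu_class v \notin C.
  apply/imsetP => -[w]; rewrite inE => /andP[_ wm] e; case/negP: iv.
  by rewrite /isotropic (form_mu_class v e).
apply: leq_trans kC _.
rewrite -(@card_in_imset _ _ (fun P : {set vec} => mu_class u |: (mu_class v |: [set P]))).
  apply: subset_leq_card; apply/subsetP => _ /imsetP[P PC ->].
  have Pu : mu_class u != P by apply: contraNneq uC => ->.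
  have Pv : mu_class v != P by apply: contraNneq vC => ->.
  have /imsetP[w] := PC; rewrite inE => /andP[wu wv] eP.
  rewrite !inE !eqxx !orbT !andbT /=; apply/and3P; split.
  - by rewrite cardsU1 cards2 Pv !inE negb_or nuv Pu.
  - by rewrite !subUset !sub1set uW vW (subsetP CW).
  apply/forall_inP => P1 h1; apply/forall_inP => P2 h2; apply/implyP.
  move: h1 h2; rewrite !inE eP.
  case/or3P => /eqP-> /or3P[] /eqP->; rewrite ?eqxx // => _; rewrite adjacentE //.
  - by rewrite formC.
  - by rewrite formC.
  - by rewrite formC.
move=> P P' PC PC' e.
have : P \in mu_class u |: (mu_class v |: [set P']) by rewrite -e !inE eqxx !orbT.
rewrite !inE => /or3P[] /eqP // h; first by rewrite -h PC in uC.
by rewrite -h PC in vC.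
Qed.

Lemma card_good_pairs :
  ((Q ^ 2 - 1) * (k * Q) <= #|good_pairs| + (Q ^ 2 * k + 2 * (Q * k * (k * Q))))%N.
Proof.
pose A := [set p : vec * vec | form p.1 p.2 \in mu].
pose B1 := [set p in A | det2 p.1 p.2 == 0].
pose B2 := [set p in A | isotropic p.1].
pose B3 := [set p in A | isotropic p.2].
have slice (S : pred (vec * vec)) : #|[set p | S p]| = \sum_u #|[set v | S (u, v)]|.
  rewrite -sum1_card (eq_bigl S) => [|p]; last by rewrite inE.
  transitivity (\sum_u \sum_v (if S (u, v) then 1 else 0))%N.
    by rewrite pair_bigA big_mkcond; apply: eq_bigr => -[u v] _.
  by apply: eq_bigr => u _; rewrite -big_mkcond -sum1_card; apply: eq_bigl => v; rewrite inE.
have cA : #|A| = ((Q ^ 2 - 1) * (k * Q))%N.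
  rewrite slice (bigD1 (0, 0)) //= (_ : #|_| = 0%N) ?add0n; last first.
    apply: eq_card0 => v; rewrite inE; apply/negP => /mu_neq0.
    by rewrite /form /= !mul0r addr0 eqxx.
  rewrite (eq_bigr (fun=> (k * Q)%N)) => [|u u0]; last exact: card_form.
  by rewrite sum_nat_const cardC1 card_prod mulnn subn1.
have c1 : (#|B1| <= Q ^ 2 * k)%N.
  rewrite (_ : B1 = [set p | (form p.1 p.2 \in mu) && (det2 p.1 p.2 == 0)]); last first.
    by apply/setP => p; rewrite !inE.
  rewrite slice -mulnn -card_prod -sum_nat_const; apply: leq_sum => u _ /=.
  have [u0|] := boolP (nonzero u); first exact: card_form_det0.
  rewrite negbK => /eqP ->; rewrite (_ : #|_| = 0%N) //.
  apply: eq_card0 => v; rewrite inE; apply/negP => /andP[/mu_neq0].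
  by rewrite /form /= !mul0r addr0 eqxx.
have c2 : (#|B2| <= Q * k * (k * Q))%N.
  rewrite (_ : B2 = [set p | (form p.1 p.2 \in mu) && isotropic p.1]); last first.
    by apply/setP => p; rewrite !inE.
  rewrite slice.
  apply: leq_trans (_ : \sum_(u in [set u | isotropic u]) (k * Q) <= _)%N; last first.
    by rewrite sum_nat_const leq_mul2r card_isotropic orbT.
  rewrite [leqRHS]big_mkcond; apply: leq_sum => u _ /=; rewrite inE.
  case: ifPn => iu; last by rewrite (_ : #|_| = 0%N) //; apply: eq_card0 => v; rewrite inE andbF.
  rewrite -(card_form (form_neq0 iu)); apply: subset_leq_card.
  by apply/subsetP => v; rewrite !inE => /andP[].
have c3 : #|B3| = #|B2|.
  rewrite -(@card_imset _ _ (fun p : vec * vec => (p.2, p.1)) B3) => [|[a b] [c d] [-> ->] //].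
  apply: eq_card => -[a b]; apply/imsetP/idP => [[[c d]]|].
    by rewrite !inE /= formC => h [-> ->].
  by rewrite !inE /= => h; exists (b, a); rewrite // !inE /= formC.
rewrite -cA; have sub : A \subset good_pairs :|: (B1 :|: (B2 :|: B3)).
  apply/subsetP => -[u v]; rewrite !inE /= => ->.
  by case: (det2 u v == 0); case: (isotropic u); case: (isotropic v).
apply: leq_trans (subset_leq_card sub) _.
apply: leq_trans (leq_card_setU _ _) _; rewrite leq_add2l.
apply: leq_trans (leq_card_setU _ _) _; apply: leq_add => //.
apply: leq_trans (leq_card_setU _ _) _; rewrite c3 mul2n -addnn.
exact: leq_add.
Qed.

(** Double counting: about k Q^3 good pairs lie in at least k triangles each, and a triangle
    contains 3 k * 2 k ordered pairs of vectors from distinct orbits. *)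
Lemma card_furedi_triangles :
  (Q ^ 3 <= 6 * #|furedi_triangles| + (2 * k + 2) * Q ^ 2)%N.
Proof.
pose T u v := [set e in furedi_triangles | (mu_class u \in e) && (mu_class v \in e)].
have lo : (#|good_pairs| * k <= \sum_(p in good_pairs) #|T p.1 p.2|)%N.
  by rewrite -sum_nat_const; apply: leq_sum => -[u v] /card_triangles_on.
have up : (\sum_(p in good_pairs) #|T p.1 p.2| <= #|furedi_triangles| * (3 * k * (2 * k)))%N.
  under eq_bigr => p _ do rewrite -sum1_card big_mkcond.
  rewrite exchange_big /= -sum_nat_const [leqRHS]big_mkcond; apply: leq_sum => e _.
  case: ifPn => eH; last first.
    by rewrite big1 // => p _; rewrite inE (negbTE eH).
  move: (eH); rewrite inE => /and3P[/eqP e3 eW _].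
  rewrite -big_mkcondr sum1_card.
  apply: leq_trans (_ : #|[set p : vec * vec | (mu_class p.1 \in e) &&
      (mu_class p.2 \in e :\ mu_class p.1)]| <= _)%N.
    apply: subset_leq_card; apply/subsetP => -[u v] /andP[gp eT].
    have /and4P[_ d _ _] : [&& form u v \in mu, det2 u v != 0, ~~ isotropic u & ~~ isotropic v].
      by rewrite inE in gp.
    have /and3P[_ ue ve] : [&& e \in furedi_triangles, mu_class u \in e & mu_class v \in e].
      by rewrite inE in eT.
    rewrite inE /= ue inE ve andbT inE.
    by apply: contraNneq d => /mu_classP[h _ ->]; rewrite /det2 /scale /=; apply/eqP; ring.
  rewrite -sum1_card (eq_bigl (fun p : vec * vec => (mu_class p.1 \in e) &&
      (mu_class p.2 \in e :\ mu_class p.1))) => [|p]; last by rewrite inE.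
  rewrite -(pair_big_dep (fun u => mu_class u \in e)
     (fun u v => mu_class v \in e :\ mu_class u) (fun _ _ => 1%N)) /=.
  apply: leq_trans (_ : \sum_(u in [set u | mu_class u \in e]) (2 * k) <= _)%N.
    rewrite (eq_bigl (fun u => u \in [set u | mu_class u \in e])) => [|u]; last by rewrite inE.
    apply: leq_sum => u; rewrite inE => ue; rewrite sum1_card.
    rewrite -(_ : #|[set v | mu_class v \in e :\ mu_class u]| = 2 * k)%N; last first.
      rewrite card_vertices_in; last exact: subset_trans (subsetDl _ _) eW.
      by have := cardsD1 (mu_class u) e; rewrite ue e3 add1n => -[<-].
    by apply: eq_leq; apply: eq_card => v; rewrite [RHS]inE.
  by rewrite sum_nat_const card_vertices_in // e3.
have := leq_trans lo up; have := card_good_pairs.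
have q1 : (1 < Q)%N := card_finNzRing_gt1 F.
set g := #|good_pairs|; set h := #|furedi_triangles|; move: (Q) q1 => q q1 h1 h2.
have {}h2 : (g <= 6 * h * k)%N by rewrite -(leq_pmul2r k_gt0); nia.
have h3 : ((q ^ 2 - 1) * q <= 6 * h + (q ^ 2 + 2 * k * q ^ 2))%N.
  rewrite -(leq_pmul2r k_gt0); move: h1 h2; rewrite -!mulnn; nia.
have : (q <= q ^ 2)%N by rewrite -{1}[q]expn1 leq_exp2l.
move: h3; rewrite mulnBl mul1n -expnSr; lia.
Qed.

End Furedi.

(** * From graphs to asymptotics *)

Section ExBerge.
Import boot.fintype boot.finset.

(* An isolated vertex of [F] could not be pulled back from ['I_n] to [W]. *)
Lemma ex_berge_ge (V U : finType) (v0 : V) (r n : nat) (F : {set {set U}})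
    (W : {set V}) (H : {set {set V}}) :
  (0 < n)%N -> (#|W| <= n)%N -> (forall e : {set V}, e \in H -> e \subset W) ->
  (forall u, exists2 e : {set U}, e \in F & u \in e) ->
  uniform r H -> ~~ contains_berge F H -> (#|H| <= ex_berge r n F)%N.
Proof.
case: n => // n _ Wn HW cov Hr Hfree.
pose io (v : V) : 'I_n.+1 := inord (index v (enum W)).
pose ka (i : 'I_n.+1) : V := nth v0 (enum W) i.
have iK v : v \in W -> ka (io v) = v.
  move=> vW; rewrite /ka /io inordK ?nth_index ?mem_enum //.
  by apply: leq_trans Wn; rewrite cardE index_mem mem_enum.
have kaK (e : {set V}) : e \subset W -> ka @: (io @: e) = e.
  move=> /subsetP eW; rewrite -imset_comp; apply/setP => v; apply/imsetP/idP.
    by move=> [w we ->]; rewrite /= iK // eW.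
  by move=> ve; exists v => //=; rewrite iK // eW.
pose H' : {set {set 'I_n.+1}} := [set io @: (e : {set V}) | e in H].
have io_inj : {in H &, injective (fun e : {set V} => io @: e)}.
  move=> e1 e2 h1 h2 /(congr1 (fun x : {set 'I_n.+1} => ka @: x)) /=.
  by rewrite !kaK // HW.
have H'P (e : {set 'I_n.+1}) : e \in H' -> [/\ ka @: e \in H, io @: (ka @: e) = e
    & {in e &, injective ka}].
  move=> /imsetP[e' eH ->]; rewrite !kaK ?HW //; split => // i j.
  move=> /imsetP[v vi ->] /imsetP[w wj ->]; have /subsetP eW := HW _ eH.
  by rewrite !iK ?eW // => ->.
have <- : #|H'| = #|H| by rewrite card_in_imset.
rewrite /ex_berge.
apply: (@leq_bigmax_cond _ _ (fun H0 : {set {set 'I_n.+1}} => #|H0|) H').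
apply/andP; split.
  apply/forall_inP => e /H'P[kH <- _]; rewrite card_in_imset; first exact: (forall_inP Hr).
  move=> v w vk wk; have /subsetP eW := HW _ kH.
  by move=> /(congr1 ka); rewrite !iK ?eW.
apply: contra Hfree => /contains_bergeP[phi [f [iphi jf h]]]; apply/contains_bergeP.
have phiW u : io (ka (phi u)) = phi u.
  have [e eF ue] := cov u; have [fH sub] := h e eF.
  have : phi u \in f e by apply: (subsetP sub); exact: imset_f.
  move: fH => /imsetP[e' eH ->] /imsetP[v ve ->]; rewrite iK //.
  by apply: (subsetP (HW _ eH)).
exists (ka \o phi), (fun e => ka @: f e); split.
- by move=> x y /= /(congr1 io); rewrite !phiW => /iphi.
- move=> x y xF yF /= /(congr1 (fun e : {set V} => io @: e)).
  have [fx _] := h x xF; have [fy _] := h y yF.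
  have [_ -> _] := H'P _ fx; have [_ -> _] := H'P _ fy; exact: jf.
move=> e eF; have [fH sub] := h e eF; have [-> _ _] := H'P _ fH; split=> //.
by rewrite imset_comp; exact: imsetS.
Qed.

Lemma complete_bipartite_cover (s t : nat) (x : 'I_s + 'I_t) : (0 < s)%N -> (0 < t)%N ->
  exists2 e : {set 'I_s + 'I_t}, e \in complete_bipartite s t & x \in e.
Proof.
move=> s0 t0; case: x => [i|j].
  exists [set inl i; inr (Ordinal t0)]; last by rewrite !inE eqxx.
  by apply/imset2P; exists i (Ordinal t0).
exists [set inl (Ordinal s0); inr j]; last by rewrite !inE eqxx orbT.
by apply/imset2P; exists (Ordinal s0) j.
Qed.

(** For r = 1 the factor C(r, 2) vanishes and the red-blue bound says nothing, so singletons are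
    counted directly. *)
Lemma ex_berge1_le (n : nat) (U : finType) (F : {set {set U}}) : (ex_berge 1 n F <= n)%N.
Proof.
apply/bigmax_leqP => H /andP[H1 _].
have sub : H \subset [set e : {set 'I_n} | e \subset [set: 'I_n] & #|e| == 1%N].
  by apply/subsetP => e eH; rewrite inE subsetT (forall_inP H1).
by have := subset_leq_card sub; rewrite cards_draws cardsT card_ord bin1.
Qed.

Lemma ex_berge_K2t_le (r n t : nat) : (2 <= r)%N ->
  exists2 e, ((2 * e) ^ 2 <= n * (2 * e + t.-1 * n ^ 2))%N &
   ('C(r, 2) * ex_berge r n (complete_bipartite 2 t) <=
     maxn 'C(r, 2) 'C(t.-1, r - 2) * e)%N.
Proof.
move=> r2; rewrite /ex_berge.
elim/big_ind: _ => [|x y [e1 a1 b1] [e2 a2 b2]|H /andP[Hr Hfree]].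
- by exists 0%N; rewrite ?muln0.
- by case: (leqP x y) => _; [exists e2 | exists e1].
- have := berge_K2t_bound r2 Hr Hfree; rewrite card_ord => -[e a b].
  by exists e.
Qed.

Lemma natural_root (N d : nat) : (0 < d)%N -> exists x, (x ^ d <= N < x.+1 ^ d)%N.
Proof.
move=> d0; elim: N => [|N [x /andP[h1 h2]]].
  by exists 0%N; rewrite exp0n // exp1n.
have [h|h] := leqP (x.+1 ^ d) N.+1; last by exists x; rewrite h (leq_trans h1).
exists x.+1; rewrite h /= (leq_ltn_trans h2) // ltn_exp2r //.
Qed.

Lemma ex_berge_furedi (k m p i n : nat) : prime p -> (0 < i)%N -> (0 < n)%N ->
  (0 < k < p)%N -> m = totient k -> (((p ^ i) ^ m) ^ 2 <= k * n)%N ->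
  (((p ^ i) ^ m) ^ 3 <= 6 * ex_berge 3 n (complete_bipartite 2 k.+1)
     + (2 * k + 2) * ((p ^ i) ^ m) ^ 2)%N.
Proof.
move=> pp i0 n0 /andP[k0 kp] mE hn.
have m0 : (0 < m)%N by rewrite mE totient_gt0.
have im0 : (0 < i * m)%N by rewrite muln_gt0 i0.
have [F _ cF] := PrimePowerField pp im0; rewrite expnM in cF.
have kq : (k %| #|F|.-1)%N.
  rewrite cF -subn1 -eqn_mod_dvd ?expn_gt0 ?prime_gt0 //; apply/eqP.
  rewrite mE; apply: Euler_exp_totient; rewrite coprimeXl // prime_coprime //.
  by rewrite gtnNdvd.
have := card_furedi_triangles kq; rewrite cF => h; apply: leq_trans h _.
rewrite leq_add2r leq_mul2l; apply/orP; right.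
apply: (@ex_berge_ge _ _ set0 3 n _ (vertices F k)) => //.
- rewrite -(leq_pmul2r k0) card_vertices // cF mulnC.
  by apply: leq_trans (leq_subr _ _) _.
- by move=> e; rewrite inE => /and3P[].
- by move=> u; exact: complete_bipartite_cover.
- exact: furedi_uniform.
- exact: furedi_free.
Qed.

End ExBerge.

(** * Absorbing lower-order terms *)

Section Asymptotics.
Variable R : realType.

Lemma powR_3half (n : nat) : (n%:R : R) `^ (3 / 2) = n%:R * Num.sqrt n%:R.
Proof.
case: n => [|n]; first by rewrite powR0 ?mul0r // mulf_neq0 ?invr_eq0 ?pnatr_eq0.
have -> : 3 / 2 = 1 + 2^-1 :> R by field.
by rewrite powRD ?pnatr_eq0 ?implybT // powRr1 // powR12_sqrt.
Qed.

Lemma cvg_to0 (o : nat -> R) :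
  (forall eps, 0 < eps -> exists N, forall n, (N <= n)%N -> `|o n| <= eps) ->
  (o @ \oo --> (0 : R))%classic.
Proof.
move=> H; apply/cvgrPdist_le => eps e0; have [N hN] := H eps e0.
by exists N => // n /= Nn; rewrite sub0r normrN hN.
Qed.

Lemma invsqrt_small (c eps : R) : 0 <= c -> 0 < eps ->
  exists N, forall n, (N <= n)%N -> c / Num.sqrt n%:R <= eps.
Proof.
move=> c0 e0; exists (Num.trunc ((c / eps) ^+ 2)).+1 => n Nn.
have h : (c / eps) ^+ 2 < n%:R by apply: lt_le_trans (truncnS_gt _) _; rewrite ler_nat.
have n0 : (0 : R) < n%:R by apply: le_lt_trans h; exact: sqr_ge0.
have s0 : 0 < Num.sqrt (n%:R : R) by rewrite sqrtr_gt0.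
rewrite ler_pdivrMr // mulrC -ler_pdivrMr //.
have q0 : 0 <= c / eps by rewrite divr_ge0 // ltW.
by rewrite -[leLHS](ger0_norm q0) -sqrtr_sqr ler_sqrt ltW.
Qed.

Lemma asymp_le_add_linear (u : nat -> R) (c c' : R) : 0 < c -> 0 <= c' ->
  (forall n, u n <= c * (n%:R * Num.sqrt n%:R) + c' * n%:R) ->
  asymp_le u (fun n => c * n%:R `^ (3 / 2)).
Proof.
move=> c0 c'0 hu; exists (fun n => c' / c / Num.sqrt n%:R).
  apply: cvg_to0 => eps e0; have q0 : 0 <= c' / c by rewrite divr_ge0 // ltW.
  have [N hN] := invsqrt_small q0 e0; exists N => n /hN.
  by rewrite ger0_norm // divr_ge0 // sqrtr_ge0.
move=> n; rewrite powR_3half; apply: le_trans (hu n) _.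
case: n => [|n]; first by rewrite !mul0r !mulr0 addr0.
have s0 : 0 < Num.sqrt (n.+1%:R : R) by rewrite sqrtr_gt0.
rewrite le_eqVlt; apply/orP; left; apply/eqP.
by set s := Num.sqrt _ in s0 *; set N := n.+1%:R; field; rewrite !gt_eqF.
Qed.

(** Solves E^2 <= N E + a N^3 without the quadratic formula: with S^2 = a N^3, E > S + N would give
    E (E - N) > (S + N) S >= S^2. *)
Lemma kst_real (n e t : nat) : (0 < t)%N -> ((2 * e) ^ 2 <= n * (2 * e + t.-1 * n ^ 2))%N ->
  2 * e%:R <= Num.sqrt (t%:R - 1) * (n%:R * Num.sqrt n%:R) + n%:R :> R.
Proof.
move=> t0; rewrite -(ler_nat R).
have -> : ((2 * e) ^ 2)%:R = (2 * e%:R) ^+ 2 :> R by rewrite natrX natrM.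
rewrite !(natrM, natrD).
have -> : t.-1%:R = t%:R - 1 :> R by rewrite -subn1 natrB.
set a : R := t%:R - 1; set N : R := n%:R; set E : R := 2 * e%:R => h.
have a0 : 0 <= a by rewrite subr_ge0 ler1n.
have N0 : 0 <= N by exact: ler0n.
pose S := Num.sqrt a * (N * Num.sqrt N).
have S0 : 0 <= S by rewrite !mulr_ge0 ?sqrtr_ge0.
have SS : S * S = a * N ^+ 3.
  have h1 := sqr_sqrtr a0; have h2 := sqr_sqrtr N0; rewrite expr2 in h1; rewrite expr2 in h2.
  transitivity ((Num.sqrt a * Num.sqrt a) * (N * N) * (Num.sqrt N * Num.sqrt N)).
    by rewrite /S; ring.
  by rewrite h1 h2; ring.
rewrite leNgt; apply/negP; rewrite -/S => lt.
have : (S + N) * S < E * (E - N).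
  have e1 : (S + N) * S <= E * S by rewrite ler_wpM2r // ltW.
  apply: le_lt_trans e1 _; rewrite ltr_pM2l ?ltrBrDr //.
  by apply: le_lt_trans lt; rewrite addr_ge0.
rewrite mulrDl SS; have : 0 <= N * S by rewrite mulr_ge0.
by move: h; rewrite expr2; clear; lra.
Qed.

End Asymptotics.

(** * The upper bounds and the lower bound for r = 3 *)

Section Final.
Variable R : realType.

Lemma ex_berge_K2t_real (r n t M : nat) : (2 <= r)%N -> (0 < t)%N ->
  (maxn 'C(r, 2) 'C(t.-1, r - 2) <= M)%N ->
  (ex_berge r n (complete_bipartite 2 t))%:R <=
  Num.sqrt (t%:R - 1) * (M%:R / ('C(r, 2)%:R * 2)) * (n%:R * Num.sqrt n%:R)
    + M%:R / ('C(r, 2)%:R * 2) * n%:R :> R.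
Proof.
move=> r2 t0 hM; have [e /(kst_real R t0) he h] := @ex_berge_K2t_le r n t r2.
have C0 : (0 : R) < 'C(r, 2)%:R by rewrite ltr0n bin_gt0.
have {}h : 'C(r, 2)%:R * (ex_berge r n (complete_bipartite 2 t))%:R <= M%:R * e%:R :> R.
  by rewrite -!natrM ler_nat (leq_trans h) // leq_mul2r hM orbT.
rewrite -(ler_pM2l C0); apply: le_trans h _.
have -> : 'C(r, 2)%:R * (Num.sqrt (t%:R - 1) * (M%:R / ('C(r, 2)%:R * 2)) * (n%:R * Num.sqrt n%:R)
    + M%:R / ('C(r, 2)%:R * 2) * n%:R) =
   M%:R * ((Num.sqrt (t%:R - 1) * (n%:R * Num.sqrt n%:R) + n%:R) / 2) :> R.
  by field; rewrite gt_eqF.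
by rewrite ler_wpM2l // ler_pdivlMr // mulrC.
Qed.

Lemma berge_upper_large_t (r t : nat) : (1 <= r)%N -> (r + 1 <= t)%N ->
  asymp_le
    (fun n : nat => (ex_berge r n (complete_bipartite 2 t))%:R : R)
    (fun n : nat => Num.sqrt (t%:R - 1) * ('C(t, r - 1))%:R
                    / (r%:R * t%:R) * n%:R `^ (3 / 2)).
Proof.
move=> r1 rt; have t1 : (1 < t)%N by lia.
have s0 : 0 < Num.sqrt (t%:R - 1) :> R by rewrite sqrtr_gt0 subr_gt0 ltr1n.
have t0R : (0 : R) < t%:R by rewrite ltr0n ltnW.
have r0R : (0 : R) < r%:R by rewrite ltr0n.
have c0 : 0 < Num.sqrt (t%:R - 1) * ('C(t, r - 1))%:R / (r%:R * t%:R) :> R.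
  by rewrite divr_gt0 ?mulr_gt0 // ltr0n bin_gt0; lia.
have [r2|r2] := leqP 2 r; last first.
  apply: (asymp_le_add_linear (c' := 1)) => // n.
  have -> : r = 1%N by lia.
  apply: le_trans (_ : n%:R <= _); first by rewrite ler_nat ex_berge1_le.
  rewrite mul1r lerDr !mulr_ge0 ?sqrtr_ge0 ?invr_ge0 ?mulr_ge0 //.
pose M := 'C(t.-1, r - 2).
have C0 : (0 : R) < 'C(r, 2)%:R by rewrite ltr0n bin_gt0.
apply: (asymp_le_add_linear (c' := M%:R / ('C(r, 2)%:R * 2))) => //.
move=> n; apply: le_trans (ex_berge_K2t_real n r2 (ltnW t1) (M := M) _) _.
  rewrite geq_max leqnn andbT -bin_sub //; apply: leq_bin2l; lia.
rewrite lerD2r le_eqVlt; apply/orP; left; apply/eqP; congr (_ * _).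
rewrite -mulrA; congr (_ * _).
case: r r2 {r1 rt c0} r0R C0 @M => [|[|r]] // _ r0R C0 M.
(* The identities t C(t-1, r-2) = (r-1) C(t, r-1) and r (r-1) = 2 C(r, 2) bring the constant to the
   stated form. *)
have e1 : (t%:R * M%:R = r.+1%:R * 'C(t, r.+1)%:R :> R).
  by rewrite -!natrM /M subSS subSS subn0 mul_bin_diag.
have e2 : (r.+2%:R * r.+1%:R = 'C(r.+2, 2)%:R * 2 :> R).
  by have := mul_bin_diag r.+2 1; rewrite bin1 /= => h; rewrite -!natrM h mulnC.
rewrite -e2 subSS subn0.
have r1 : (0 : R) < r.+1%:R by rewrite ltr0n.
have -> : M%:R = r.+1%:R * 'C(t, r.+1)%:R / t%:R :> R.
  by rewrite -e1 [t%:R * _]mulrC mulfK // gt_eqF.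
have rn := ler0n R r.
by field; rewrite (gt_eqF t0R) /= !gt_eqF //; lra.
Qed.

Lemma berge_upper_small_t (r t : nat) : (2 <= t)%N -> (t <= r)%N ->
  asymp_le
    (fun n : nat => (ex_berge r n (complete_bipartite 2 t))%:R : R)
    (fun n : nat => Num.sqrt (t%:R - 1) / 2 * n%:R `^ (3 / 2)).
Proof.
move=> t2 tr; have r2 : (2 <= r)%N by apply: leq_trans tr.
have C0 : (0 : R) < 'C(r, 2)%:R by rewrite ltr0n bin_gt0.
apply: (asymp_le_add_linear (c' := 1 / 2)) => //.
  by rewrite divr_gt0 // sqrtr_gt0 subr_gt0 ltr1n.
move=> n; apply: le_trans (ex_berge_K2t_real n r2 (ltnW t2) (M := 'C(r, 2)) _) _.
  rewrite geq_max leqnn /=.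
  (* For t <= r the clique count is at most C(r-1, r-2) = r - 1, which C(r, 2) dominates. *)
  apply: leq_trans (_ : 'C(r.-1, r - 2) <= _)%N; first by apply: leq_bin2l; lia.
  case: r r2 {tr C0} => [|[|r]] // _; rewrite /= subSS subSS subn0 binSn.
  have := mul_bin_diag r.+2 1; rewrite bin1 /=; nia.
have -> : 'C(r, 2)%:R / ('C(r, 2)%:R * 2) = 1 / 2 :> R by field; rewrite gt_eqF.
by rewrite mul1r.
Qed.

Lemma one_sub_exp (d : R) j : 0 <= d <= 1 -> 1 - j%:R * d <= (1 - d) ^+ j.
Proof.
move=> /andP[d0 d1]; elim: j => [|j IH]; first by rewrite mul0r subr0 expr0.
have h : 0 <= 1 - d by rewrite subr_ge0.
rewrite exprS; have := ler_wpM2l h IH; have : 0 <= j%:R * (d * d) by rewrite !mulr_ge0.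
by rewrite -natr1; clear; lra.
Qed.

(** With x the integer 2m-th root of k n, take a prime power q just below x and Q = q^m: then Q^2 <=
    k n, so the graph fits into n vertices, and Q^3 is close to (k n)^(3/2). *)
Lemma ex_berge_K2t_lower (k : nat) (eps : R) : (0 < k)%N -> 0 < eps < 1 ->
  exists N, forall n, (N <= n)%N ->
  (1 - eps) * (1 / 6 * (k%:R * n%:R * Num.sqrt (k%:R * n%:R))) <=
    (ex_berge 3 n (complete_bipartite 2 k.+1))%:R.
Proof.
move=> k0 /andP[e0 e1]; pose m := totient k.
have m0 : (0 < m)%N by rewrite totient_gt0.
(* The number of factors 1 - d lost: passing from x + 1 to x and from x to q costs two for each of
   the m powers in Q, hence 6 m in Q^3, and the quadratic error term takes one more. *)
pose J : R := (6 * m + 1)%:R; have J1 : 1 <= J by rewrite ler1n; lia.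
pose d := eps / J.
have J0 : 0 < J by apply: lt_le_trans J1.
have d0 : 0 < d by rewrite divr_gt0.
have dJ : J * d = eps by rewrite /d mulrC divfK // gt_eqF.
have d1 : d < 1.
  by apply: le_lt_trans e1; rewrite -dJ ler_peMl // ltW.
clearbody d.
have [X hX] := @prime_power_dense R k d (ltac:(by rewrite d0)).
(* Ensures d (1 - d) x >= 2 k + 2, which bounds the quadratic error by d Q^3 and also gives (1 -
   d)(x + 1) <= x. *)
pose Y := maxn X (Num.trunc ((2 * k + 2)%:R / (d * (1 - d)))).+1.
have d1' : 0 < 1 - d by rewrite subr_gt0.
exists (Y.+1 ^ (m * 2)).+1 => n Nn.
have n0 : (0 < n)%N by apply: leq_trans Nn.
have m20 : (0 < m * 2)%N by rewrite muln_gt0 m0.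
have [x /andP[x1 x2]] := natural_root (k * n) m20.
have xY : (Y <= x)%N.
  rewrite -ltnS -(ltn_exp2r _ _ m20); apply: leq_ltn_trans x2.
  apply: leq_trans (_ : n <= _)%N; last by rewrite leq_pmull.
  apply: leq_trans (ltnW Nn); by rewrite leq_exp2r.
move: (xY); rewrite geq_max => /andP[xX xT].
have [p [i [pp kp i0 qx xq]]] := hX x xX.
have x0 : (0 < x)%N by apply: leq_trans xT.
have xR : (2 * k + 2)%:R / (d * (1 - d)) <= x%:R :> R.
  by apply/ltW/(lt_le_trans (truncnS_gt _)); rewrite ler_nat.
set q := (p ^ i)%N in qx xq; pose Q := (q ^ m)%N.
have Qn : (Q ^ 2 <= k * n)%N.
  by rewrite /Q -expnM; apply: leq_trans x1; rewrite leq_exp2r.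
have := @ex_berge_furedi k m p i n pp i0 n0 (ltac:(by rewrite k0)) erefl Qn.
rewrite -/q -/Q => lo.
have q0 : (0 < q)%N by rewrite expn_gt0 prime_gt0.
have d2 : 0 < d * (1 - d) by rewrite mulr_gt0.
have dx : (2 * k + 2)%:R <= d * ((1 - d) * x%:R) :> R.
  by move: xR; rewrite ler_pdivrMr // => h; rewrite mulrA mulrC.
have x1d : (1 - d) * (x%:R + 1) <= x%:R.
  have h1 : 2 <= (2 * k + 2)%:R :> R by rewrite ler_nat leq_addl.
  have h2 : d * ((1 - d) * x%:R) <= d * x%:R.
    by rewrite ler_pM2l // ler_piMl // lerBlDr lerDl ltW.
  clear -h1 h2 dx d0; lra.
pose s : R := (x%:R + 1) ^+ m.
have sQ : (1 - d) ^+ (2 * m) * s <= Q%:R.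
  rewrite /Q natrX /s exprM -exprMn.
  have main : (1 - d) ^+ 2 * (x%:R + 1) <= q%:R.
    rewrite expr2 -mulrA; apply: le_trans xq; by rewrite ler_pM2l.
  have main0 : 0 <= (1 - d) ^+ 2 * (x%:R + 1) by rewrite mulr_ge0 ?sqr_ge0 ?addr_ge0.
  by apply: (lerXn2r m _ _ main); rewrite nnegrE // ler0n.
have s0 : 0 < s by rewrite exprn_gt0 // ltr_wpDl.
have ys : k%:R * n%:R <= s ^+ 2 :> R.
  by rewrite /s -exprM natr1 -natrX -natrM ler_nat ltnW.
have sy : Num.sqrt (k%:R * n%:R) <= s.
  by rewrite -(ger0_norm (ltW s0)) -sqrtr_sqr ler_sqrt // exprn_ge0 // ltW.
have yy : k%:R * n%:R * Num.sqrt (k%:R * n%:R) <= s ^+ 3 :> R.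
  by rewrite exprSr ler_pM ?mulr_ge0 ?sqrtr_ge0.
have Q3 : ((1 - d) ^+ (2 * m) * s) ^+ 3 <= Q%:R ^+ 3.
  have P0 : 0 <= (1 - d) ^+ (2 * m) * s by rewrite mulr_ge0 ?exprn_ge0 // ltW.
  by apply: (lerXn2r 3 _ _ sQ); rewrite nnegrE // ler0n.
have QL : (2 * k + 2)%:R <= d * Q%:R.
  apply: le_trans dx _; rewrite ler_pM2l //; apply: le_trans xq _.
  by rewrite ler_nat /Q -{1}[q]expn1 leq_pexp2l.
have {}lo : Q%:R ^+ 3 <= 6 * (ex_berge 3 n (complete_bipartite 2 k.+1))%:R
    + (2 * k + 2)%:R * Q%:R ^+ 2 :> R.
  by rewrite -!natrX -!natrM -natrD ler_nat.
have L2 : (2 * k + 2)%:R * Q%:R ^+ 2 <= d * Q%:R ^+ 3 :> R.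
  have -> : d * Q%:R ^+ 3 = d * Q%:R * Q%:R ^+ 2 by ring.
  by rewrite ler_wpM2r // exprn_ge0.
have B : 1 - eps <= (1 - d) * ((1 - d) ^+ (2 * m)) ^+ 3.
  rewrite -exprM -exprS.
  have -> : eps = (2 * m * 3).+1%:R * d.
    by rewrite -dJ /J mulnAC addn1.
  by apply: one_sub_exp; rewrite (ltW d0) (ltW d1).
have fin : (1 - eps) * s ^+ 3 <= 6 * (ex_berge 3 n (complete_bipartite 2 k.+1))%:R.
  apply: le_trans (_ : (1 - d) * ((1 - d) ^+ (2 * m)) ^+ 3 * s ^+ 3 <= _).
    by rewrite ler_wpM2r // exprn_ge0 // ltW.
  rewrite -mulrA -exprMn.
  apply: le_trans (_ : (1 - d) * Q%:R ^+ 3 <= _); first by rewrite ler_pM2l.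
  clear -lo L2; lra.
have f2 : (1 - eps) * (k%:R * n%:R * Num.sqrt (k%:R * n%:R)) <= (1 - eps) * s ^+ 3.
  by rewrite ler_pM2l // subr_gt0.
clear -fin f2; lra.
Qed.

End Final.

Theorem theorem13 (R : realType) (r t : nat) (hr : (1 <= r)%N) (ht : (2 <= t)%N) :
  [/\ (r + 1 <= t)%N ->
      asymp_le
        (fun n : nat => (ex_berge r n (complete_bipartite 2 t))%:R : R)
        (fun n : nat => Num.sqrt (t%:R - 1) * ('C(t, r - 1))%:R
                        / (r%:R * t%:R) * n%:R `^ (3 / 2)),
      (t <= r)%N ->
      asymp_le
        (fun n : nat => (ex_berge r n (complete_bipartite 2 t))%:R : R)
        (fun n : nat => Num.sqrt (t%:R - 1) / 2 * n%:R `^ (3 / 2))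
    & r = 3%N -> (4 <= t)%N ->
      asymp_eq
        (fun n : nat => (ex_berge 3 n (complete_bipartite 2 t))%:R : R)
        (fun n : nat => 1 / 6 * (t%:R - 1) `^ (3 / 2) * n%:R `^ (3 / 2))].
Proof.
split; [exact: berge_upper_large_t | exact: berge_upper_small_t |].
move=> _ t4.
pose u n : R := (ex_berge 3 n (complete_bipartite 2 t))%:R.
pose v n : R := 1 / 6 * (t%:R - 1) `^ (3 / 2) * n%:R `^ (3 / 2).
have [k tk k0] : exists2 k, t = k.+1 & (0 < k)%N by exists t.-1; lia.
have tkR : t%:R - 1 = k%:R :> R by rewrite tk -natr1 addrK.
have vE n : v n = 1 / 6 * (k%:R * n%:R * Num.sqrt (k%:R * n%:R)).
  by rewrite /v tkR !powR_3half sqrtrM ?ler0n //; ring.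
have up n : u n <= v n + 1 / 6 * k%:R * n%:R.
  have k3 : (3 <= k)%N by rewrite -ltnS -tk.
  have c3 : 'C(3, 2) = 3%N by [].
  (* Here t >= 4 enters: k >= 3 = C(3, 2), so the red edges set the constant. *)
  have hM : (maxn 'C(3, 2) 'C(t.-1, 3 - 2) <= k)%N.
    by rewrite c3 tk bin1 geq_max k3 leqnn.
  apply: le_trans (ex_berge_K2t_real R n (isT : (2 <= 3)%N) (ltnW ht) hM) _.
  rewrite tkR vE sqrtrM ?ler0n // c3; clear; lra.
have v0 n : (0 < n)%N -> 0 < v n.
  move=> n0; rewrite vE; have kn : (0 : R) < k%:R * n%:R by rewrite mulr_gt0 ?ltr0n.
  by rewrite !mulr_gt0 ?sqrtr_gt0 ?invr_gt0 ?ltr0n.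
(* At n = 0 the comparison function vanishes and the quotient carries no information; both sides are
   0 there. *)
exists (fun n => if n is 0%N then 0 else u n / v n - 1); last first.
  move=> [|n]; rewrite -/(u _) -/(v _).
    apply/eqP; rewrite eq_le; have v00 : v 0%N = 0 by rewrite vE mulr0 mul0r mulr0.
    by have := up 0%N; rewrite v00 !mulr0 addr0 => ->; rewrite ler0n.
  by rewrite addrC subrK divfK // gt_eqF // v0.
(* The cap at 1/2 meets the requirement eps < 1 of the lower bound. *)
apply: cvg_to0 => eps e0; pose eps' := Num.min eps (1 / 2).
have e'0 : 0 < eps' by rewrite lt_min e0 divr_gt0.
have e'1 : eps' < 1 by rewrite gt_min; apply/orP; right; lra.
have e'e : eps' <= eps by rewrite ge_min lexx.
have [N1 h1] := ex_berge_K2t_lower k0 (ltac:(by rewrite e'0) : 0 < eps' < 1).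
have [N2 h2] := @invsqrt_small R 1 eps ler01 e0.
exists (maxn N1 (maxn N2 1)) => n; rewrite !geq_max => /and3P[n1 n2 n3].
case: n n1 n2 n3 => // n n1 n2 _; set N := n.+1 in n1 n2 *.
have vN := v0 N isT.
have lo := h1 N n1; rewrite -vE -tk -/(u N) in lo.
have hi : u N <= v N + eps * v N.
  apply: le_trans (up N) _; rewrite lerD2l vE.
  have := h2 N n2; have s0 : 0 < Num.sqrt (N%:R : R) by rewrite sqrtr_gt0 ltr0n.
  rewrite ler_pdivrMr // => h3.
  have sk : Num.sqrt (N%:R : R) <= Num.sqrt (k%:R * N%:R).
    by rewrite ler_sqrt ?mulr_ge0 // ler_peMl // ler1n.
  have h4 : 1 <= eps * Num.sqrt (k%:R * N%:R) by apply: le_trans h3 _; rewrite ler_pM2l.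
  have kN : (0 : R) <= k%:R * N%:R by rewrite mulr_ge0.
  have := ler_wpM2l kN h4; clear; lra.
rewrite ler_norml lerBlDr ler_pdivrMr // lerBrDr ler_pdivlMr //.
apply/andP; split; last by clear -hi; lra.
apply: le_trans lo; rewrite ler_pM2r //; clear -e'e; lra.
Qed.
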